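(* Let $d\ge 1$ and $n\ge 1$ be integers, let $\beta>0$ be real, and fix $\epsilon\in(0,1)$. Suppose $\hat\theta\colon(\mathbb{R}^d\times\{-1,1\})^n\to S^{d-1}$ is an estimator such that, for every $\theta^\star\in S^{d-1}$, $$\mathbb{E}\big[\,\|\hat\theta((\mathbf{x}_i,\mathbf{y}_i)_{i=1}^n)-\theta^\star\|\,\big]\le\epsilon,$$ where the expectation is over i.i.d. data $(\mathbf{x}_1,\mathbf{y}_1),\dots,(\mathbf{x}_n,\mathbf{y}_n)$ drawn from the logistic regression model with parameter $\theta^\star$ and inverse temperature $\beta$. Then $$n\ \ge\ \frac{(d-1)\ln 2-\ln 4}{32\,\epsilon^2\,\beta\,\min\{\beta,\,2\sqrt{2/\pi}\}}.$$
   Context: $\|\cdot\|$ is the Euclidean norm on $\mathbb{R}^d$ and $S^{d-1}=\{\theta\in\mathbb{R}^d:\|\theta\|=1\}$. Logistic regression model with parameter $\theta\in S^{d-1}$ and inverse temperature $\beta$: $\mathbf{x}\sim N(0,I_d)$ is a standard normal vector in $\mathbb{R}^d$ and, conditionally on $\mathbf{x}$, $\mathbf{y}\in\{-1,1\}$ equals $1$ with probability $g'(\beta\,\mathbf{x}^{\top}\theta)$, where $g'(\eta)=1/(1+e^{-\eta})$. An estimator is a measurable map from the data space to $S^{d-1}$ (it may depend on $\beta$, $d$, $n$, $\epsilon$). *)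

(* Defs.v *)
From HB Require Import structures.
From mathcomp Require Import all_boot all_order all_algebra.
From mathcomp Require Import all_classical all_reals all_analysis.
From mathcomp Require Import measurable_realfun.

Set Implicit Arguments.
Unset Strict Implicit.
Unset Printing Implicit Defensive.

Import Order.TTheory GRing.Theory Num.Theory.
Import numFieldNormedType.Exports.

Local Open Scope classical_set_scope.
Local Open Scope ring_scope.

(* Points of R^d are [d.-tuple R]: unlike ['rV[R]_d], this type carries the
   product (= Borel) sigma-algebra. The norm on ['rV[R]_d] would also be the
   sup norm instead of the Euclidean one. *)
Section euclidean.
Context {R : realType} {d : nat}.
Implicit Types x y : d.-tuple R.

Definition dotv x y : R := \sum_(i < d) tnth x i * tnth y i.

Definition subv x y : d.-tuple R := [tuple tnth x i - tnth y i | i < d].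

Definition enorm x : R := Num.sqrt (dotv x x).

Definition sphere : set (d.-tuple R) := [set x | enorm x = 1].

Lemma measurable_dotv_l y : measurable_fun [set: d.-tuple R] (dotv ^~ y).
Proof.
rewrite /dotv; apply: measurable_sum => i.
by apply: measurable_funM => //; exact: measurable_tnth.
Qed.

End euclidean.

Section iid.
Context {disp : measure_display} {T : measurableType disp} {R : realType}.

Definition cons_tuple n (xt : T * n.-tuple T) : n.+1.-tuple T :=
  [the n.+1.-tuple T of xt.1 :: xt.2].

Lemma measurable_cons_tuple n :
  measurable_fun [set: T * n.-tuple T] (@cons_tuple n).
Proof. exact: measurable_cons. Qed.

HB.instance Definition _ n :=
  isMeasurableFun.Build _ _ _ _ (@cons_tuple n) (@measurable_cons_tuple n).

(* The law of n i.i.d. draws from P, i.e. the n-fold product measure; it is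
   characterized by [iid_probE]. *)
Fixpoint iid_prob (P : probability T R) (n : nat) :
    probability (n.-tuple T) R :=
  match n return probability (n.-tuple T) R with
  | 0 => \d_([tuple] : 0.-tuple T)
  | m.+1 => distribution (P \x iid_prob P m)%E (@cons_tuple m)
  end.

Lemma iid_probE (P : probability T R) n (A : 'I_n -> set T) :
  (forall i, measurable (A i)) ->
  iid_prob P n [set t | forall i, A i (tnth t i)] = (\prod_(i < n) P (A i))%E.
Proof.
elim: n A => [|n IHn] A mA.
  by rewrite big_ord0 /= diracE mem_set// => -[].
pose B := [set t : n.-tuple T | forall i, A (lift ord0 i) (tnth t i)].
have mB : measurable B.
  have -> : B = \bigcap_(i in [set: 'I_n]) ((@tnth n T)^~ i @^-1` A (lift ord0 i)).
    by apply/seteqP; split => [t Bt i _|t Bt i]; [exact: Bt|exact: Bt i I].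
  apply: fin_bigcap_measurable => [|i _]; first exact: finite_finset.
  by rewrite -[X in measurable X]setTI; exact: measurable_tnth.
rewrite big_ord_recl -(IHn (fun i => A (lift ord0 i)))// -product_measure1E//=.
rewrite /distribution /pushforward; congr (_ _).
apply/seteqP; split => -[x t] /=.
- move=> At; split; first by have := At ord0; rewrite tnth0.
  by move=> i; have := At (lift ord0 i); rewrite tnthS.
- move=> -[Ax Bt] i; case: (unliftP ord0 i) => [j ->|->].
    by rewrite tnthS; exact: Bt.
  by rewrite tnth0.
Qed.

End iid.

Section logistic_regression.
Context {R : realType}.

Definition sigmoid (eta : R) : R := (1 + expR (- eta))^-1.

Lemma sigmoid_itv eta : 0 <= sigmoid eta <= 1.
Proof.
have e0 : 1 <= 1 + expR (- eta) by rewrite lerDl expR_ge0.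
by rewrite /sigmoid invr_ge0 (le_trans ler01 e0) invf_le1// (lt_le_trans ltr01 e0).
Qed.

Lemma measurable_sigmoid : measurable_fun [set: R] sigmoid.
Proof.
apply: continuous_measurable_fun => x; rewrite /sigmoid.
apply: cvgV; first by rewrite gt_eqF// ltr_pwDl// ltW// expR_gt0.
apply: cvgD; first exact: cvg_cst.
apply: (continuous_comp (f := fun z : R => - z)); last exact: continuous_expR.
exact: opp_continuous.
Qed.

(* [normal_prob] is a measure on [measurableTypeR R], which has the same
   measurable sets as [R] but another display; [std_normal] transports it to
   [R] along the identity, so that it is unchanged as a set function. *)
Definition idTR : measurableTypeR R -> R := idfun.

HB.instance Definition _ :=
  @isMeasurableFun.Build _ _ _ _ idTR (@measurable_id _ _ setT).

Definition std_normal : probability R R :=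
  distribution (normal_prob 0 1) idTR.

Lemma std_normalE (A : set R) : std_normal A = normal_prob 0 1 A.
Proof. by []. Qed.

Definition std_gaussian (d : nat) : probability (d.-tuple R) R :=
  iid_prob std_normal d.

Section law.
Context {d : nat} (theta : d.-tuple R) (beta : R).
Local Open Scope ereal_scope.

(* Labels are booleans, [true] standing for 1 and [false] for -1. *)
Definition label_prob (x : d.-tuple R) : probability bool R :=
  bernoulli_prob (sigmoid (beta * dotv x theta)).

Lemma label_probE x :
  label_prob x [set true] = (sigmoid (beta * dotv x theta))%:E.
Proof.
by rewrite [LHS]bernoulli_probE ?sigmoid_itv// !diracE mem_set// memNset//
  mule1 mule0 adde0.
Qed.

Lemma measurable_label_prob :
  measurable_fun setT (label_prob : d.-tuple R -> pprobability bool R).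
Proof.
apply: (measurableT_comp measurable_bernoulli_prob).
apply: (measurableT_comp measurable_sigmoid).
by apply: measurable_funM => //; exact: measurable_dotv_l.
Qed.

(* The joint law of (x, y): x is drawn first, then y given x. *)
Definition logistic_law (A : set (d.-tuple R * bool)) : \bar R :=
  \int[std_gaussian d]_x label_prob x (xsection A x).

Let law0 : logistic_law set0 = 0.
Proof. by apply: integral0_eq => x _; rewrite xsection0 measure0. Qed.

Let law_ge0 A : 0 <= logistic_law A.
Proof. exact: integral_ge0. Qed.

Let law_sigma_additive : semi_sigma_additive logistic_law.
Proof.
have mk A : measurable A ->
    measurable_fun setT (fun x => label_prob x (xsection A x)).
  move=> mA; have /= := @measurable_fun_xsection_finite_kernel _ _ _ _ R
    (kprobability measurable_label_prob) A.
  by apply; rewrite inE.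
move=> F mF tF mUF.
rewrite [X in _ --> X](_ : _ = \sum_(n <oo) logistic_law (F n)).
  by apply/cvg_closeP; split; [exact: is_cvg_nneseries|rewrite closeE].
rewrite -integral_nneseries//; last by move=> n; exact: mk.
apply: eq_integral => x _; apply/esym/cvg_lim => //=; rewrite xsection_bigcup.
apply: (measure_sigma_additive _ (trivIset_xsection tF)) => ?.
exact: measurable_xsection.
Qed.

HB.instance Definition _ := isMeasure.Build _ _ _ logistic_law
  law0 law_ge0 law_sigma_additive.

Let law_setT : logistic_law setT = 1.
Proof.
rewrite /logistic_law (eq_integral (cst 1)); last first.
  by move=> x _; rewrite xsectionE preimage_setT [LHS]probability_setT.
by rewrite integral_cst// mul1e [LHS]probability_setT.
Qed.

HB.instance Definition _ :=
  Measure_isProbability.Build _ _ _ logistic_law law_setT.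

End law.

End logistic_regression.

(* Main.v *)
Require Import Defs.
From mathcomp Require Import all_boot all_order all_algebra.
From mathcomp Require Import all_classical all_reals all_analysis.
From mathcomp Require Import measurable_realfun ring lra.

Set Implicit Arguments.
Unset Strict Implicit.
Unset Printing Implicit Defensive.

Import Order.TTheory GRing.Theory Num.Theory.
Import numFieldNormedType.Exports.
Local Open Scope classical_set_scope.
Local Open Scope ring_scope.

(** The statement is a minimax lower bound, and the proof is an Assouad argument on a
    hypercube inscribed in the sphere. Put m = d - 1; for m <= 2 the left-hand side is
    nonpositive. For 0 < s <= 1 the 2^m unit vectors
      theta_v = (sqrt (1 - s^2), s v / sqrt m),  v in {-1, 1}^m
    ([vertex]) are the candidate parameters, and the risk bound is averaged over v.

    Distance between two laws is measured through a variational form of the Hellinger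
    affinity: ∫ g dP + ∫ 1/g dQ >= 2 - 2 delta for every bounded measurable g that is
    bounded away from 0 ([hellinger_le]). By Cauchy-Schwarz the optimal value is twice
    the affinity of P and Q, so this needs no densities; it adds up under products
    ([hellinger_le_prod], [hellinger_le_iid]), and testing it with
    g = sqrt (1 + k^2 f^2) - k f compares the means of f under P and Q in terms of
    the second moments of f ([hellinger_le_diff]).

    For one observation delta is at most a quarter of the symmetrised Kullback-Leibler
    divergence, that is, of the Gaussian mean of (a - b) (sigmoid a - sigmoid b), where
    a, b are the two logits ([label_hellinger]). For two adjacent vertices
    a, b = beta (w +- c x_j) with c = s / sqrt m and w independent of x_j. The sigmoid is
    1/4-Lipschitz, which gives order beta^2 c^2. Moreover w is centred normal with
    variance 1 - c^2 ([std_gaussian_coord_dotv], from the stability of the normal law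
    under sums, [integral_std_normal_conv]), and shifting a normal variable by +- u changes the
    mean of a [0, 1]-valued function by at most the mass of [-u, u]
    ([std_normal_shift_gap]), which gives order beta c^2. Together delta is at most
    5/16 K c^2 with K = beta min (beta, 2 sqrt (2 / pi))
    ([logistic_law_hellinger]).

    Hence, if F_j does not depend on the j-th sign of v, the average over v of the mean of
    v_j F_j is small unless n K c^2 is large ([sum_flip_le]). Two choices of F_j
    conclude.
    - If eps <= 1/2, take s = 2 eps and let F_j be the j-th tail coordinate of the
      estimate, rescaled by 1/c and truncated to [-1, 1]. The loss is at least
      s (1 - the average of v_j F_j) ([vertex_dist_clamp]), so the average of v_j F_j
      has mean at least 1/2.
    - If eps > 1/2, take s = 1. A bound linear in the correlation t of estimate and
      parameter is vacuous near eps = 1, since an estimate equal to plus or minus the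
      parameter with equal odds has mean loss 1. The loss is bounded below through
      t + t^2 instead ([enorm_subv_sphere_ge]), and t + t^2 is at most 1/m plus a
      sum of terms v_j F_j ([dotv_vertex_cross]).
    In both cases the resulting bound on n K exceeds (m - 2) / (32 eps^2), and
    ln 2 <= 1. *)

(** * Integration against mixtures and densities *)

Section mixture.
Local Open Scope ereal_scope.
Import HBNNSimple.

(** The defining identity nu A = ∫ k x A dmu is the case of indicators; it extends to
    nonnegative simple functions by linearity and to all nonnegative measurable
    functions by monotone convergence. *)
Lemma ge0_integral_mixture d1 d2 (X : measurableType d1)
    (Z : measurableType d2) (R : realType) (mu : {measure set X -> \bar R})
    (k : X -> {measure set Z -> \bar R}) (nu : {measure set Z -> \bar R}) :
  (forall A, measurable A -> measurable_fun [set: X] (k ^~ A)) ->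
  (forall A, measurable A -> nu A = \int[mu]_x k x A) ->
  forall f : Z -> \bar R, measurable_fun [set: Z] f -> (forall z, 0 <= f z) ->
  \int[nu]_z f z = \int[mu]_x \int[k x]_z f z.
Proof.
move=> mk nuE f mf f0.
have simple (h : {nnsfun Z >-> R}) :
    \int[nu]_z (h z)%:E = \int[mu]_x \int[k x]_z (h z)%:E.
  rewrite integralT_nnsfun sintegralE.
  under [in RHS]eq_integral do rewrite integralT_nnsfun sintegralE.
  rewrite ge0_integral_fsum//; last 2 first.
  - move=> r; apply: measurable_funeM; exact: mk.
  - by move=> r x _; rewrite nnsfun_mulemu_ge0.
  apply: eq_fsbigr => r _.
  have [r0|r0] := leP 0%R r.
    by rewrite nuE// ge0_integralZl//; exact: mk.
  rewrite preimage_nnfun0// measure0 mule0 integral0_eq// => x _.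
  by rewrite measure0 mule0.
pose f_ := nnsfun_approx measurableT mf.
have lim_f (m : {measure set Z -> \bar R}) :
    \int[m]_z f z = limn (fun n => \int[m]_z (f_ n z)%:E).
  rewrite -monotone_convergence//=.
  - by apply: eq_integral => z _; apply/esym/cvg_lim => //=; exact: cvg_nnsfun_approx.
  - by move=> n; exact/measurable_EFinP.
  - by move=> n z _; rewrite lee_fin.
  - by move=> z _ a b ab; rewrite lee_fin; exact/lefP/nd_nnsfun_approx.
rewrite lim_f; under [in RHS]eq_integral do rewrite lim_f.
rewrite monotone_convergence//.
- by congr (limn _); apply/funext => n; exact: simple.
- move=> n; apply: measurable_fun_integral_kernel => //.
  + by move=> z; rewrite lee_fin.
  + exact/measurable_EFinP.
- by move=> n x _; apply: integral_ge0 => z _; rewrite lee_fin.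
- move=> x _ a b ab; apply: ge0_le_integral => //=.
  + by move=> z _; rewrite lee_fin.
  + exact/measurable_EFinP.
  + exact/measurable_EFinP.
  + by move=> z _; rewrite lee_fin; exact/lefP/nd_nnsfun_approx.
Qed.

(** A measure with density w is the mixture of the point masses w(x) delta_x. *)
Lemma ge0_integral_density d (T : measurableType d) (R : realType)
    (mu nu : {measure set T -> \bar R}) (w : T -> R) :
  measurable_fun [set: T] w -> (forall x, (0 <= w x)%R) ->
  (forall A, measurable A -> nu A = \int[mu]_(x in A) (w x)%:E) ->
  forall f : T -> \bar R, measurable_fun [set: T] f -> (forall x, 0 <= f x) ->
  \int[nu]_x f x = \int[mu]_x (f x * (w x)%:E).
Proof.
move=> mw w0 nuE f mf f0.
rewrite (@ge0_integral_mixture _ _ T T R mu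
  (fun x => mscale (NngNum (w0 x)) (dirac x)) nu)//.
- apply: eq_integral => x _.
  by rewrite ge0_integral_mscale// integral_dirac//= diracT mul1e muleC.
- move=> A mA; apply: emeasurable_funM; first exact/measurable_EFinP.
  exact: measurable_fun_dirac.
- move=> A mA; rewrite nuE// integral_mkcond; apply: eq_integral => x _.
  by rewrite /= /mscale/= patchE diracE; case: ifPn; rewrite ?mule1 ?mule0.
Qed.

End mixture.

Section logistic_integral.
Context {R : realType} {d : nat} (theta : d.-tuple R) (beta : R).
Local Open Scope ereal_scope.

(** The logistic law is the mixture over x of the images of the label laws under
    y |-> (x, y), and a Bernoulli integral is a two-term sum. *)
Lemma integral_logistic_law (f : d.-tuple R * bool -> \bar R) :
  measurable_fun setT f -> (forall z, 0 <= f z) ->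
  \int[logistic_law theta beta]_z f z =
  \int[std_gaussian d]_x
    ((sigmoid (beta * dotv x theta))%:E * f (x, true) +
     (1 - sigmoid (beta * dotv x theta))%:E * f (x, false)).
Proof.
move=> mf f0.
pose pr (x : d.-tuple R) := pushforward (label_prob theta beta x) (pair x).
have mpair (x : d.-tuple R) : measurable_fun [set: bool] (pair x) by exact: pair1_measurable.
rewrite (@ge0_integral_mixture _ _ _ _ R (std_gaussian d) pr)//.
- apply: eq_integral => x _.
  rewrite ge0_integral_pushforward//= integral_bernoulli_prob//.
  exact: sigmoid_itv.
- move=> A mA; rewrite /pr/pushforward.
  have := @measurable_fun_xsection_finite_kernel _ _ _ _ R
    (kprobability (measurable_label_prob theta beta)) A.
  by rewrite inE => /(_ mA); under eq_fun do rewrite xsectionE.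
- by move=> A mA; apply: eq_integral => x _; rewrite xsectionE.
Qed.

End logistic_integral.

(** * Gaussian integrals *)

Section lebesgue_affine.
Context {R : realType}.
Local Notation mu := (@lebesgue_measure R).
Local Notation phi := (normal_pdf 0 1 : R -> R).
Local Open Scope ereal_scope.

Lemma integral_std_normal (F : R -> \bar R) :
  measurable_fun [set: R] F -> (forall x, 0 <= F x) ->
  \int[std_normal]_x F x = \int[mu]_x (F x * (phi x)%:E).
Proof.
move=> mF F0; rewrite /std_normal ge0_integral_distribution//=.
rewrite (@ge0_integral_density _ _ _ mu (normal_prob 0 1) phi)//.
- exact: measurable_normal_pdf.
- by move=> x; exact: normal_pdf_ge0.
Qed.

(** The measure A |-> a * lebesgue {x | a x + b in A} agrees with the Lebesgue
    measure on half-open intervals. *)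
Lemma integral_lebesgue_affine (a b : R) (F : R -> \bar R) : (0 < a)%R ->
  measurable_fun [set: R] F -> (forall x, 0 <= F x) ->
  \int[mu]_x F x = a%:E * \int[mu]_x F (a * x + b)%R.
Proof.
move=> a0 mF F0.
pose g : measurableTypeR R -> measurableTypeR R := fun x => (a * x + b)%R.
have mg : measurable_fun [set: measurableTypeR R] g.
  by apply: measurable_funD => //; apply: measurable_funM.
pose a' := NngNum (ltW a0).
pose nu0 : {measure set (measurableTypeR R) -> \bar R} :=
  mscale a' (pushforward mu g).
pose nu := nu0 mg.
have -> : \int[mu]_x F x = \int[nu]_x F x.
  apply: eq_measure_integral => A mA _.
  apply: (@lebesgue_measure_unique R nu) => //.
  move=> _ [[u v]] _ <-; rewrite /nu/nu0/= /mscale/= /pushforward.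
  have -> : g @^-1` [set` `]u, v]%R] = [set` `](u - b) / a, (v - b) / a]%R].
    apply/seteqP; split => x /=; rewrite !in_itv/= ltr_pdivrMr// ler_pdivlMr//;
      by rewrite ltrBlDr lerBrDr mulrC.
  rewrite !lebesgue_measure_itv/= !lte_fin ltr_pM2r ?invr_gt0// ltrBlDr subrK.
  case: ifPn => _; last by rewrite mule0.
  rewrite -!EFinB -EFinM; congr (_%:E); field; exact: lt0r_neq0.
rewrite ge0_integral_mscale// ge0_integral_pushforward//.
Qed.

Lemma integral_lebesgue_opp (F : R -> \bar R) :
  measurable_fun [set: R] F -> (forall x, 0 <= F x) ->
  \int[mu]_x F (- x)%R = \int[mu]_x F x.
Proof.
move=> mF F0.
have mN : measurable_fun [set: measurableTypeR R]
  (-%R : measurableTypeR R -> measurableTypeR R) by [].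
rewrite -[LHS](ge0_integral_pushforward mN mu measurableT)//.
by apply: eq_measure_integral => A mA _; exact: lebesgue_measureN.
Qed.

Lemma normal_pdf01E x : phi x = (normal_peak 1 * expR (- x ^+ 2 / 2))%R.
Proof.
by rewrite normal_pdfE ?oner_neq0// /normal_fun subr0 expr1n.
Qed.

Lemma normal_pdf01N x : phi (- x)%R = phi x.
Proof. by rewrite !normal_pdf01E sqrrN. Qed.

Lemma le_normal_pdf01 x y : (y ^+ 2 <= x ^+ 2)%R -> (phi x <= phi y)%R.
Proof.
move=> yx; rewrite !normal_pdf01E ler_pM2l ?normal_peak_gt0 ?oner_neq0//.
by rewrite ler_expR !mulNr lerN2 ler_pM2r.
Qed.

(** Completing the square: with s^2 = a^2 + b^2, the sum x^2 + ((y - a x) / b)^2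
    equals (y / s)^2 + ((x - a y / s^2) s / b)^2. *)
Lemma normal_pdf01_rotate (a b s x y : R) : b != 0%R -> s != 0%R ->
  (s ^+ 2 = a ^+ 2 + b ^+ 2)%R ->
  (phi x * phi ((y - a * x) / b) =
   phi (y / s) * phi ((x - a * y / s ^+ 2) * s / b))%R.
Proof.
move=> b0 s0 sE; rewrite !normal_pdf01E !mulrA.
rewrite -[LHS]mulrA -[RHS]mulrA.
rewrite [LHS]mulrACA [RHS]mulrACA -!expRD; congr (_ * expR _)%R.
apply/eqP; rewrite -subr_eq0; apply/eqP.
transitivity ((a ^+ 2 + b ^+ 2 - s ^+ 2) *
  (y ^+ 2 / (s ^+ 2 * b ^+ 2) - x ^+ 2 / b ^+ 2) / 2)%R.
  by field; rewrite s0 b0.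
by rewrite -sE subrr !mul0r.
Qed.

Lemma integral_normal_pdf01 : \int[mu]_x (phi x)%:E = 1.
Proof. exact: integral_normal_pdf. Qed.

End lebesgue_affine.

Section gaussian_convolution.
Context {R : realType}.
Local Notation mu := (@lebesgue_measure R).
Local Notation phi x := (normal_pdf 0%R 1%R x%R).
Local Open Scope ereal_scope.

Lemma measurable_affine_fun (a b : R) :
  measurable_fun [set: R] (fun x => a * x + b)%R.
Proof. by apply: measurable_funD => //; exact: measurable_funM. Qed.

Lemma measurable_normal_pdf01 : measurable_fun [set: R] (normal_pdf 0 1).
Proof. exact: measurable_normal_pdf. Qed.

Lemma normal_pdf01_ge0 (x : R) : 0 <= (phi x)%:E.
Proof. by rewrite lee_fin normal_pdf_ge0. Qed.

Lemma integral_lebesgue_scale (a b : R) (F : R -> \bar R) : (0 < a)%R ->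
  measurable_fun [set: R] F -> (forall x, 0 <= F x) ->
  \int[mu]_y (F y * (phi ((y - b) / a))%:E) =
  a%:E * \int[std_normal]_x F (a * x + b)%R.
Proof.
move=> a0 mF F0.
have mphi : measurable_fun [set: R] (fun y => phi ((y - b) / a)).
  have /(measurableT_comp measurable_normal_pdf01) := measurable_affine_fun a^-1 (- b / a).
  by apply: eq_measurable_fun => x _ /=; congr (phi _); ring.
rewrite (integral_lebesgue_affine b a0)//; last 2 first.
- by apply: emeasurable_funM => //; exact/measurable_EFinP.
- by move=> x; rewrite mule_ge0// normal_pdf01_ge0.
have mFab : measurable_fun [set: R] (fun x => F (a * x + b)%R).
  exact: measurableT_comp mF (measurable_affine_fun a b).
rewrite (integral_std_normal mFab (fun x => F0 _)).
have E (x : R) : ((a * x + b - b) / a = x)%R by rewrite addrK mulrAC divff ?mul1r// gt_eqF.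
by under eq_integral do rewrite E.
Qed.

Lemma integral_std_normal_opp (F : R -> \bar R) :
  measurable_fun [set: R] F -> (forall x, 0 <= F x) ->
  \int[std_normal]_x F (- x)%R = \int[std_normal]_x F x.
Proof.
move=> mF F0.
rewrite [LHS]integral_std_normal//; last exact: measurableT_comp.
rewrite [RHS]integral_std_normal//.
have mFphi : measurable_fun [set: R] (fun x => F x * (phi x)%:E).
  apply: emeasurable_funM; first exact: mF.
  by apply/measurable_EFinP; exact: measurable_normal_pdf01.
have Fphi0 (x : R) : 0 <= F x * (phi x)%:E by rewrite mule_ge0// normal_pdf01_ge0.
rewrite -(integral_lebesgue_opp mFphi Fphi0).
by under [in RHS]eq_integral do rewrite normal_pdf01N.
Qed.

Let conv_pos (a b : R) (F : R -> \bar R) : (0 < b)%R ->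
  measurable_fun [set: R] F -> (forall x, 0 <= F x) ->
  \int[std_normal]_x \int[std_normal]_z F (a * x + b * z)%R =
  \int[std_normal]_z F (Num.sqrt (a ^+ 2 + b ^+ 2) * z)%R.
Proof.
move=> b0 mF F0; set s := Num.sqrt _.
have s2 : (s ^+ 2 = a ^+ 2 + b ^+ 2)%R by rewrite sqr_sqrtr// addr_ge0// sqr_ge0.
have s0 : (0 < s)%R by rewrite sqrtr_gt0 ltr_wpDl// ?sqr_ge0// exprn_gt0.
have bs0 : (0 < b / s)%R by exact: divr_gt0.
pose h (p : R * R) := F p.2 * (b^-1 * phi ((p.2 - a * p.1) / b) * phi p.1)%:E.
have mh : measurable_fun setT h.
  apply: emeasurable_funM; first exact: measurableT_comp mF measurable_snd.
  apply/measurable_EFinP/measurable_funM; last first.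
    exact: measurableT_comp measurable_normal_pdf01 measurable_fst.
  apply: measurable_funM => //.
  apply: measurableT_comp measurable_normal_pdf01 _.
  apply: measurable_funM => //; apply: measurable_funB; first exact: measurable_snd.
  by apply: measurable_funM => //; exact: measurable_fst.
have h0 p : 0 <= h p.
  by rewrite mule_ge0// lee_fin !mulr_ge0// ?normal_pdf_ge0// invr_ge0 ltW.
transitivity (\int[mu]_x \int[mu]_y h (x, y)).
  rewrite [LHS]integral_std_normal; last 2 first.
  - apply: (@measurable_fun_fubini_tonelli_F _ _ _ _ _ std_normal
      (fun p : R * R => F (a * p.1 + b * p.2)%R)) => //.
    apply: measurableT_comp mF _; by apply: measurable_funD; exact: measurable_funM.
  - by move=> x; exact: integral_ge0.
  apply: eq_integral => x _.
  have -> : \int[std_normal]_z F (a * x + b * z)%R =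
      b^-1%:E * \int[mu]_y (F y * (phi ((y - a * x) / b))%:E).
    rewrite (integral_lebesgue_scale (a * x) b0 mF F0) muleA -EFinM.
    rewrite mulVf ?gt_eqF// mul1e.
    by under [in RHS]eq_integral do rewrite addrC.
  have m1 : measurable_fun [set: R] (fun y => F y * (phi ((y - a * x) / b))%:E).
    apply: emeasurable_funM; [exact: mF|apply/measurable_EFinP].
    apply: measurableT_comp measurable_normal_pdf01 _.
    by apply: measurable_funM => //; exact: measurable_funB.
  rewrite muleAC -EFinM -(ge0_integralZl mu measurableT m1); last 2 first.
  - by move=> y _; rewrite mule_ge0// normal_pdf01_ge0.
  - by rewrite lee_fin mulr_ge0 ?normal_pdf_ge0// invr_ge0 ltW.
  apply: eq_integral => y _.
  by rewrite /h/= muleCA -EFinM; congr (_ * _%:E); ring.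
rewrite (@fubini_tonelli _ _ _ _ _ mu mu h mh h0).
transitivity (\int[mu]_y (F y * (s^-1 * phi (y / s))%:E)).
  apply: eq_integral => y _.
  transitivity (\int[mu]_x ((F y * (b^-1 * phi (y / s))%:E) *
      (phi ((x - a * y / s ^+ 2) / (b / s)))%:E)).
    apply: eq_integral => x _; rewrite /h/= -muleA -EFinM; congr (_ * _%:E).
    rewrite -mulrA [(phi _ * phi x)%R]mulrC (@normal_pdf01_rotate _ a b s) ?gt_eqF//.
    by rewrite invf_div !mulrA.
  rewrite (@integral_lebesgue_scale _ _ (fun _ => F y * (b^-1 * phi (y / s))%:E)).
  - rewrite integral_cst//= probability_setT mule1 muleCA -EFinM.
    by congr (_ * _%:E); field; rewrite !gt_eqF.
  - exact: bs0.
  - exact: measurable_cst.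
  - by move=> _; rewrite mule_ge0// lee_fin mulr_ge0 ?normal_pdf_ge0// invr_ge0 ltW.
have msF : measurable_fun [set: R] (fun y => F y * (phi ((y - 0) / s))%:E).
  apply: emeasurable_funM; [exact: mF|apply/measurable_EFinP].
  apply: measurableT_comp measurable_normal_pdf01 _.
  by apply: measurable_funM => //; exact: measurable_funB.
transitivity (s^-1%:E * \int[mu]_y (F y * (phi ((y - 0) / s))%:E)).
  rewrite -(ge0_integralZl mu measurableT msF); last 2 first.
  - by move=> y _; rewrite mule_ge0// normal_pdf01_ge0.
  - by rewrite lee_fin invr_ge0 ltW.
  by apply: eq_integral => y _; rewrite subr0 muleCA -EFinM.
rewrite (integral_lebesgue_scale 0 s0 mF F0) muleA -EFinM mulVf ?gt_eqF// mul1e.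
by under eq_integral do rewrite addr0.
Qed.

(** Stability of the normal law: a X + b Z is distributed as sqrt (a^2 + b^2) Z
    for independent standard normal X and Z. For b > 0 it follows from
    the density identity [normal_pdf01_rotate] after exchanging the integrals; for
    b = 0 it is the symmetry of the law. *)
Lemma integral_std_normal_conv (a b : R) (F : R -> \bar R) : (0 <= b)%R ->
  measurable_fun [set: R] F -> (forall x, 0 <= F x) ->
  \int[std_normal]_x \int[std_normal]_z F (a * x + b * z)%R =
  \int[std_normal]_z F (Num.sqrt (a ^+ 2 + b ^+ 2) * z)%R.
Proof.
rewrite le_eqVlt => /predU1P[<-|b0] mF F0; last exact: conv_pos.
rewrite expr0n/= addr0 sqrtr_sqr.
transitivity (\int[std_normal]_x F (a * x)%R).
  apply: eq_integral => x _; under eq_integral do rewrite mul0r addr0.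
  by rewrite integral_cst//= probability_setT mule1.
have [a0|a0] := leP 0%R a; first by rewrite ger0_norm.
have mFa : measurable_fun [set: R] (fun x => F (- a * x)%R).
  by apply: measurableT_comp mF _; exact: measurable_funM.
rewrite ltr0_norm// -(integral_std_normal_opp mFa (fun x => F0 _)).
by under [in RHS]eq_integral do rewrite mulrNN.
Qed.

End gaussian_convolution.

Section gaussian_estimates.
Context {R : realType}.
Local Notation mu := (@lebesgue_measure R).
Local Notation phi x := (normal_pdf 0%R 1%R x%R).
Local Open Scope ereal_scope.

Lemma std_normal_itv_le (u : R) : (0 <= u)%R ->
  std_normal `](- u)%R, u]%classic <= (2 * u * normal_peak 1)%:E.
Proof.
move=> u0; rewrite std_normalE /normal_prob.
apply: (@le_trans _ _ (\int[mu]_(x in `](- u)%R, u]%classic) (normal_peak 1)%:E)).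
  apply: ge0_le_integral => //.
  - by move=> x _; exact: normal_pdf01_ge0.
  - by apply/measurable_EFinP; apply: measurable_funTS; exact: measurable_normal_pdf.
  - by move=> x _; rewrite lee_fin normal_pdf_ub// oner_neq0.
rewrite integral_cst//= lebesgue_measure_itv/= lte_fin.
case: ifPn => [_|_]; last first.
  by rewrite mule0 lee_fin !mulr_ge0// normal_peak_ge0.
by rewrite -EFinB -EFinM lee_fin le_eqVlt; apply/orP; left; apply/eqP; ring.
Qed.

Lemma integral_std_normal_shift (u : R) (F : R -> \bar R) :
  measurable_fun [set: R] F -> (forall x, 0 <= F x) ->
  \int[std_normal]_x F (x + u)%R = \int[mu]_y (F y * (phi (y - u))%:E).
Proof.
move=> mF F0.
under [RHS]eq_integral do rewrite -[(_ - u)%R]divr1.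
rewrite (integral_lebesgue_scale u ltr01 mF F0) mul1e.
by under [RHS]eq_integral do rewrite mul1r.
Qed.

(** After a change of variables both sides integrate G against the shifted densities
    phi (y - u) and phi (y + u). The former is the larger exactly for y >= 0, so their
    difference is largest when G is the indicator of the positive half-line, for which it
    is the mass of ]-u, u]. *)
Lemma std_normal_shift_gap (G : R -> R) (u : R) : (0 <= u)%R ->
  measurable_fun [set: R] G -> (forall x, 0 <= G x <= 1)%R ->
  \int[std_normal]_x (G (x + u))%:E <=
  \int[std_normal]_x (G (x - u))%:E + (2 * u * normal_peak 1)%:E.
Proof.
move=> u0 mG G01.
have mG' : measurable_fun [set: R] (EFin \o G) by exact/measurable_EFinP.
have G0 x : 0 <= (G x)%:E by rewrite lee_fin; case/andP: (G01 x).
pose I (y : R) : R := \1_(`]0%R, +oo[%classic : set R) y.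
have mI : measurable_fun [set: R] (EFin \o I).
  by apply/measurable_EFinP; exact: measurable_indic.
have I0 (x : R) : 0 <= (I x)%:E by rewrite lee_fin.
have mphi (c : R) : measurable_fun [set: R] (fun y => (phi (y - c))%:E).
  apply/measurable_EFinP; apply: measurableT_comp measurable_normal_pdf01 _.
  exact: measurable_funB.
have intI (c : R) : \int[std_normal]_x (I (x + c))%:E = std_normal `](- c)%R, +oo[%classic.
  transitivity (\int[std_normal]_x (\1_(`](- c)%R, +oo[%classic : set R) x)%:E).
    apply: eq_integral => x _; rewrite /I !indicE; congr ((nat_of_bool _)%:R%:E).
    by apply/idP/idP; rewrite !inE/= !in_itv/= !andbT; lra.
  by rewrite integral_indic ?setIT//; exact: measurable_itv.
have key : \int[std_normal]_x (G (x + u))%:E + \int[std_normal]_x (I (x - u))%:E <=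
    \int[std_normal]_x (G (x - u))%:E + \int[std_normal]_x (I (x + u))%:E.
  rewrite (integral_std_normal_shift _ mG' G0) (integral_std_normal_shift _ mI I0).
  rewrite (integral_std_normal_shift _ mG' G0) (integral_std_normal_shift _ mI I0).
  have mGphi c : measurable_fun [set: R] (fun y => (G y)%:E * (phi (y - c))%:E).
    exact: emeasurable_funM.
  have mIphi c : measurable_fun [set: R] (fun y => (I y)%:E * (phi (y - c))%:E).
    exact: emeasurable_funM.
  have Gphi0 c (y : R) : 0 <= (G y)%:E * (phi (y - c))%:E by rewrite mule_ge0// normal_pdf01_ge0.
  have Iphi0 c (y : R) : 0 <= (I y)%:E * (phi (y - c))%:E by rewrite mule_ge0// normal_pdf01_ge0.
  rewrite -[leLHS](ge0_integralD mu measurableT (fun y _ => Gphi0 u y) (mGphi u)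
    (fun y _ => Iphi0 (- u)%R y) (mIphi (- u)%R)).
  rewrite -[leRHS](ge0_integralD mu measurableT (fun y _ => Gphi0 (- u)%R y) (mGphi (- u)%R)
    (fun y _ => Iphi0 u y) (mIphi u)).
  apply: ge0_le_integral => //.
  - by move=> y _; rewrite adde_ge0.
  - exact: emeasurable_funD (mGphi _) (mIphi _).
  - exact: emeasurable_funD (mGphi _) (mIphi _).
  move=> y _; rewrite -!EFinM -!EFinD lee_fin opprK.
  have /andP[Gy0 Gy1] := G01 y.
  have IE : I y = (0 < y)%R%:R.
    rewrite /I indicE; congr ((nat_of_bool _)%:R).
    by apply/idP/idP; rewrite inE/= in_itv/= andbT.
  rewrite IE; case: (ltP 0%R y) => y0.
    have : (phi (y + u) <= phi (y - u))%R by apply: le_normal_pdf01; nra.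
    rewrite !mul1r; nra.
  have : (phi (y - u) <= phi (y + u))%R by apply: le_normal_pdf01; nra.
  rewrite !mul0r !addr0; nra.
have split : std_normal `](- u)%R, +oo[%classic =
    std_normal `](- u)%R, u]%classic + std_normal `]u, +oo[%classic.
  rewrite -measureU//; first by rewrite -itv_bndbnd_setU// bnd_simp; lra.
  by apply/seteqP; split => // x /= []; rewrite !in_itv/= => /andP[_ xu]; rewrite andbT; lra.
have intIN : \int[std_normal]_x (I (x - u))%:E = std_normal `]u, +oo[%classic.
  by rewrite intI opprK.
move: key; rewrite intIN (intI u) split.
have fin : std_normal `]u, +oo[%classic \is a fin_num by exact: fin_num_measure.
have cancel (X Y p q : \bar R) : q \is a fin_num -> X + q <= Y + (p + q) -> X <= Y + p.
  by move=> qfin; rewrite addeA leeD2rE.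
move=> /(cancel _ _ _ _ fin)/le_trans; apply.
by apply: leeD => //; exact: std_normal_itv_le.
Qed.

(** For s > 1 write phi (x / s) = phi x * exp (k x^2) with k = (1 - 1 / s^2) / 2.
    The left-hand side integrates to s, and exp (k x^2) >= 1 + k x^2, so the second moment
    is at most (s - 1) / k = 2 s^2 / (s + 1); let s tend to 1. *)
Lemma std_normal_sqr_le1 : \int[std_normal]_x (x ^+ 2 : R)%:E <= 1.
Proof.
have msq : measurable_fun [set: R] (fun x : R => (x ^+ 2)%:E).
  by apply/measurable_EFinP; exact: measurable_funX.
have sq0 (x : R) : 0 <= (x ^+ 2)%:E by rewrite lee_fin sqr_ge0.
apply/lee_addgt0Pr => e e0.
pose s : R := (1 + e / 2)%R.
have s1 : (1 < s)%R by rewrite /s; lra.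
have s0 : (0 < s)%R by lra.
pose k : R := ((1 - s ^- 2) / 2)%R.
have k0 : (0 < k)%R by rewrite divr_gt0// subr_gt0 invf_lt1 ?exprn_gt0// exprn_egt1.
have key : 1 + k%:E * \int[std_normal]_x (x ^+ 2 : R)%:E <= s%:E.
  have -> : s%:E = \int[mu]_x (phi ((x - 0) / s))%:E.
    have := @integral_lebesgue_scale R s 0%R (cst 1) s0 (measurable_cst _) (fun=> lee01).
    rewrite integral_cst//= probability_setT !mule1 => <-.
    by apply: eq_integral => x _; rewrite mul1e.
  rewrite -(ge0_integralZl std_normal measurableT msq) ?lee_fin ?(ltW k0)//.
  rewrite integral_std_normal; last 2 first.
  - exact: measurable_funeM.
  - by move=> x; rewrite mule_ge0// lee_fin ltW.
  rewrite -(@integral_normal_pdf01 R) -ge0_integralD//; first last.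
  - apply: emeasurable_funM; first exact: measurable_funeM.
    by apply/measurable_EFinP; exact: measurable_normal_pdf01.
  - by move=> x _; rewrite mule_ge0 ?normal_pdf01_ge0// mule_ge0// lee_fin ltW.
  - by apply/measurable_EFinP; exact: measurable_normal_pdf01.
  - by move=> x _; rewrite normal_pdf01_ge0.
  apply: ge0_le_integral => //.
  - by move=> x _; rewrite adde_ge0// ?mule_ge0 ?normal_pdf01_ge0// lee_fin ltW.
  - apply: emeasurable_funD.
      by apply/measurable_EFinP; exact: measurable_normal_pdf01.
    apply: emeasurable_funM; first exact: measurable_funeM.
    by apply/measurable_EFinP; exact: measurable_normal_pdf01.
  - apply/measurable_EFinP; apply: measurableT_comp measurable_normal_pdf01 _.
    by apply: measurable_funM => //; exact: measurable_funB.
  move=> x _; rewrite -!EFinM -EFinD lee_fin subr0 !normal_pdf01E.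
  have -> : (- (x / s) ^+ 2 / 2 = - x ^+ 2 / 2 + k * x ^+ 2)%R.
    by rewrite /k; field; rewrite gt_eqF.
  rewrite expRD; set p := normal_peak 1; set q := expR _.
  have pq0 : (0 <= p * q)%R by rewrite mulr_ge0 ?expR_ge0 ?normal_peak_ge0.
  have -> : (p * q + k * x ^+ 2 * (p * q) = p * q * (1 + k * x ^+ 2))%R by ring.
  by rewrite [leRHS]mulrA ler_wpM2l// expR_ge1Dx.
have fin : \int[std_normal]_x (x ^+ 2 : R)%:E \is a fin_num.
  rewrite ge0_fin_numE; last exact: integral_ge0.
  rewrite ltNge leye_eq; apply/negP => /eqP E.
  by move: key; rewrite E gt0_muley ?lte_fin// addey// leye_eq.
move: key; rewrite -(fineK fin); set M := fine _.
rewrite -EFinM -!EFinD !lee_fin => key.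
have kE : (k * (2 * s ^+ 2) = (s - 1) * (s + 1))%R.
  by rewrite /k; field; rewrite gt_eqF.
have : (M * ((s - 1) * (s + 1)) <= (s - 1) * (2 * s ^+ 2))%R.
  rewrite -kE; have : (0 <= 2 * s ^+ 2)%R by nra.
  nra.
have sE : s = (1 + e / 2)%R by [].
rewrite mulrCA ler_pM2l; last by lra.
have -> : (2 * s ^+ 2 = (s + 1) * (1 + e) - e / 2 * 1)%R by rewrite sE; field.
nra.
Qed.

End gaussian_estimates.

(** * Linear forms in a standard Gaussian vector *)

Section iid_integral.
Context {disp : measure_display} {T : measurableType disp} {R : realType}.
Local Open Scope ereal_scope.

Lemma integral_iid_probS (P : probability T R) n (F : n.+1.-tuple T -> \bar R) :
  measurable_fun setT F -> (forall t, 0 <= F t) ->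
  \int[iid_prob P n.+1]_t F t =
  \int[P]_x \int[iid_prob P n]_t F (Defs.cons_tuple (x, t)).
Proof.
move=> mF F0; rewrite [LHS]ge0_integral_distribution//.
rewrite (@fubini_tonelli1 _ _ _ _ _ P (iid_prob P n) (F \o @Defs.cons_tuple _ _ n))//.
- by apply: measurableT_comp mF _; exact: measurable_cons_tuple.
- by move=> z; exact: F0.
Qed.

End iid_integral.

Section gaussian_vector.
Context {R : realType}.
Local Open Scope ereal_scope.

Lemma dotv_cons d (x a : R) (t u : d.-tuple R) :
  (dotv (Defs.cons_tuple (x, t)) (Defs.cons_tuple (a, u)) = x * a + dotv t u)%R.
Proof.
rewrite /dotv big_ord_recl !tnth0; congr (_ + _)%R.
by apply: eq_bigr => i _; rewrite !tnthS.
Qed.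

Lemma dotv_ge0 d (x : d.-tuple R) : (0 <= dotv x x)%R.
Proof. by apply: sumr_ge0 => i _; rewrite -expr2 sqr_ge0. Qed.

Lemma enorm_cons d (a : R) (u : d.-tuple R) :
  enorm (Defs.cons_tuple (a, u)) = Num.sqrt (a ^+ 2 + enorm u ^+ 2).
Proof. by rewrite /enorm dotv_cons sqr_sqrtr ?dotv_ge0// expr2. Qed.

Lemma integral_std_normal_cst (c : \bar R) : 0 <= c -> \int[std_normal]_(_ in setT) c = c.
Proof.
by move=> c0; rewrite (integral_cst std_normal measurableT)//= probability_setT mule1.
Qed.

(** Induction on the dimension: each step adds one coordinate, by stability. *)
Lemma std_gaussian_dotv d (theta : d.-tuple R) (F : R -> \bar R) :
  measurable_fun [set: R] F -> (forall x, 0 <= F x) ->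
  \int[std_gaussian d]_x F (dotv x theta) =
  \int[std_normal]_z F (enorm theta * z)%R.
Proof.
elim: d theta F => [|d IHd] theta F mF F0.
  rewrite /enorm /dotv big_ord0 sqrtr0.
  under eq_integral do rewrite big_ord0.
  rewrite integral_cst//= diracT mule1.
  by under eq_integral do rewrite mul0r; rewrite integral_std_normal_cst.
have -> : theta = Defs.cons_tuple (thead theta, behead_tuple theta).
  by rewrite [LHS]tuple_eta; apply: val_inj.
move: (thead theta) (behead_tuple theta) => a u {theta}.
rewrite [LHS]integral_iid_probS; last 2 first.
- by apply: measurableT_comp mF _; exact: measurable_dotv_l.
- by [].
transitivity (\int[std_normal]_x \int[std_normal]_z F (a * x + enorm u * z)%R).
  apply: eq_integral => x _; under eq_integral do rewrite dotv_cons [(x * a)%R]mulrC.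
  apply: (IHd u (fun y => F (a * x + y)%R)) => //.
  by apply: measurableT_comp mF _; exact: measurable_funD.
by rewrite (integral_std_normal_conv a (sqrtr_ge0 _) mF F0) enorm_cons.
Qed.

(** Since theta vanishes at j, the form x |-> dotv x theta ignores the j-th
    coordinate: the pair is distributed as (z, enorm theta * w) with z and w independent
    standard normal. *)
Lemma std_gaussian_coord_dotv d (j : 'I_d) (theta : d.-tuple R)
    (h : R * R -> \bar R) : tnth theta j = 0%R ->
  measurable_fun setT h -> (forall p, 0 <= h p) ->
  \int[std_gaussian d]_x h (tnth x j, dotv x theta) =
  \int[std_normal]_z \int[std_normal]_w h (z, enorm theta * w)%R.
Proof.
elim: d j theta h => [[]//|d IHd] j theta h.
have -> : theta = Defs.cons_tuple (thead theta, behead_tuple theta).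
  by rewrite [LHS]tuple_eta; apply: val_inj.
move: (thead theta) (behead_tuple theta) => a u {theta} theta0 mh h0.
rewrite [LHS]integral_iid_probS; last 2 first.
- apply: measurableT_comp mh _; apply/measurable_fun_pairP; split.
    exact: measurable_tnth.
  exact: measurable_dotv_l.
- by [].
have [k jk|j0] := unliftP ord0 j; last first.
  move: theta0; rewrite j0 tnth0/= => ->.
  apply: eq_integral => x _.
  under eq_integral do rewrite dotv_cons mulr0 add0r tnth0/=.
  rewrite (@std_gaussian_dotv _ _ (fun y => h (x, y))) ?enorm_cons//.
    by rewrite expr0n add0r sqrtr_sqr ger0_norm ?sqrtr_ge0.
  by apply: measurableT_comp mh _; exact: pair1_measurable.
rewrite jk tnthS in theta0 *.
transitivity (\int[std_normal]_x \int[std_normal]_z \int[std_normal]_w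
    h (z, a * x + enorm u * w)%R).
  apply: eq_integral => x _.
  under eq_integral do rewrite dotv_cons tnthS [(x * a)%R]mulrC.
  apply: (IHd k u (fun p => h (p.1, a * x + p.2)%R)) => //.
  apply: measurableT_comp mh _; apply/measurable_fun_pairP; split.
    exact: measurable_fst.
  by apply: measurable_funD => //; exact: measurable_snd.
pose f (p : R * R) := \int[std_normal]_w h (p.2, a * p.1 + enorm u * w)%R.
have mf : measurable_fun setT f.
  apply: (@measurable_fun_fubini_tonelli_F _ _ _ _ _ std_normal
    (fun q : (R * R) * R => h (q.1.2, a * q.1.1 + enorm u * q.2)%R)) => //.
  apply: measurableT_comp mh _; apply/measurable_fun_pairP; split.
    exact: measurableT_comp measurable_snd measurable_fst.
  apply: measurable_funD; apply: measurable_funM => //.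
  exact: measurableT_comp measurable_fst measurable_fst.
have f0 p : 0 <= f p by exact: integral_ge0.
rewrite (@fubini_tonelli _ _ _ _ _ std_normal std_normal f mf f0).
apply: eq_integral => z _; rewrite /f/=.
rewrite (@integral_std_normal_conv _ a (enorm u) (fun y => h (z, y))) ?sqrtr_ge0//.
  by rewrite enorm_cons.
by apply: measurableT_comp mh _; exact: pair1_measurable.
Qed.

End gaussian_vector.

(** * Bounded measurable functions and a variational Hellinger distance *)

Section bounded_measurable.
Context {disp : measure_display} {T : measurableType disp} {R : realType}.
Implicit Types (f g : T -> R) (P Q : probability T R).

(** For a probability measure this class is stable under all the operations needed below
    and makes every integral finite, so that expectations can be real numbers. *)
Definition bounded_mfun f :=
  measurable_fun [set: T] f /\ exists M, forall x, `|f x| <= M.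

Lemma bounded_mfun_cst (c : R) : bounded_mfun (fun=> c).
Proof. by split; [exact: measurable_cst|exists `|c|]. Qed.

Lemma bounded_mfunD f g : bounded_mfun f -> bounded_mfun g ->
  bounded_mfun (fun x => f x + g x).
Proof.
move=> [mf [M fM]] [mg [N gN]]; split; first exact: measurable_funD.
by exists (M + N) => x; rewrite (le_trans (ler_normD _ _))// lerD.
Qed.

Lemma bounded_mfunM f g : bounded_mfun f -> bounded_mfun g ->
  bounded_mfun (fun x => f x * g x).
Proof.
move=> [mf [M fM]] [mg [N gN]]; split; first exact: measurable_funM.
by exists (M * N) => x; rewrite normrM ler_pM.
Qed.

Lemma bounded_mfun_sum I (r : seq I) (F : I -> T -> R) :
  (forall i, bounded_mfun (F i)) -> bounded_mfun (fun x => \sum_(i <- r) F i x).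
Proof.
move=> bF; elim: r => [|i r IHr].
  under eq_fun do rewrite big_nil; exact: bounded_mfun_cst.
under eq_fun do rewrite big_cons; exact: bounded_mfunD.
Qed.

Lemma bounded_mfunZ (c : R) f : bounded_mfun f -> bounded_mfun (fun x => c * f x).
Proof. by move=> bf; apply: bounded_mfunM bf; exact: bounded_mfun_cst. Qed.

Lemma bounded_mfunB f g : bounded_mfun f -> bounded_mfun g ->
  bounded_mfun (fun x => f x - g x).
Proof.
move=> bf bg; apply: bounded_mfunD => //.
under eq_fun do rewrite -mulN1r; exact: bounded_mfunZ.
Qed.

Lemma bounded_mfunX f n : bounded_mfun f -> bounded_mfun (fun x => f x ^+ n).
Proof.
move=> bf; elim: n => [|n IHn].
  under eq_fun do rewrite expr0; exact: bounded_mfun_cst.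
under eq_fun do rewrite exprS; exact: bounded_mfunM.
Qed.

Lemma bounded_mfun_itv f (lo hi : R) : measurable_fun [set: T] f ->
  (forall x, lo <= f x <= hi) -> bounded_mfun f.
Proof.
move=> mf fb; split => //; exists (`|lo| + `|hi|) => x.
have /andP[lof fhi] := fb x.
rewrite ler_norml; have := normr_ge0 lo; have := normr_ge0 hi.
have := ler_norm hi; have := ler_norm (- lo); rewrite normrN; lra.
Qed.

Lemma inv_itv (g : T -> R) lo hi : 0 < lo -> (forall x, lo <= g x <= hi) ->
  forall x, hi^-1 <= (g x)^-1 <= lo^-1.
Proof.
move=> lo0 gb x; have /andP[logx gxhi] := gb x.
have gx0 : 0 < g x by exact: lt_le_trans logx.
by rewrite !lef_pV2 ?posrE// ?gxhi ?logx// (lt_le_trans gx0).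
Qed.

Lemma measurable_inv_pos (g : T -> R) : measurable_fun [set: T] g ->
  (forall x, 0 < g x) -> measurable_fun [set: T] (fun x => (g x)^-1).
Proof.
move=> mg g0.
have -> : (fun x => (g x)^-1) = (fun x => (g x) `^ (-1)).
  by apply/funext => x; rewrite powR_inv1// ltW.
exact: (measurableT_comp (measurable_powR (- 1)) mg).
Qed.

Lemma bounded_mfun_inv f lo hi : 0 < lo -> measurable_fun [set: T] f ->
  (forall x, lo <= f x <= hi) -> bounded_mfun (fun x => (f x)^-1).
Proof.
move=> lo0 mf fb; apply: (@bounded_mfun_itv _ hi^-1 lo^-1).
  apply: measurable_inv_pos => // x.
  by have /andP[+ _] := fb x; exact: lt_le_trans.
exact: inv_itv.
Qed.

Section expectation.
Variable P : probability T R.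

Lemma bounded_mfun_integrable f : bounded_mfun f ->
  P.-integrable [set: T] (EFin \o f).
Proof.
move=> [mf [M fM]]; apply: measurable_bounded_integrable => //.
  by rewrite [X in (X < _)%E]probability_setT ltry.
by exists M; split; [exact: num_real|move=> N MN x _; exact: le_trans (ltW MN)].
Qed.

Lemma EFin_Rintegral f : bounded_mfun f ->
  (\int[P]_x f x)%:E = (\int[P]_x (f x)%:E)%E.
Proof.
by move=> /bounded_mfun_integrable bf; rewrite /Rintegral fineK//; exact: integrable_fin_num.
Qed.

Lemma prob_RintegralD f g : bounded_mfun f -> bounded_mfun g ->
  \int[P]_x (f x + g x) = \int[P]_x f x + \int[P]_x g x.
Proof. by move=> bf bg; rewrite RintegralD//; exact: bounded_mfun_integrable. Qed.

Lemma prob_RintegralB f g : bounded_mfun f -> bounded_mfun g ->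
  \int[P]_x (f x - g x) = \int[P]_x f x - \int[P]_x g x.
Proof. by move=> bf bg; rewrite RintegralB//; exact: bounded_mfun_integrable. Qed.

Lemma prob_RintegralZ c f : bounded_mfun f -> \int[P]_x (c * f x) = c * \int[P]_x f x.
Proof. by move=> bf; rewrite RintegralZl//; exact: bounded_mfun_integrable. Qed.

Lemma prob_Rintegral_cst c : \int[P]_x c = c.
Proof. by rewrite Rintegral_cst// [X in fine X]probability_setT mulr1. Qed.

Lemma prob_le_Rintegral f g : bounded_mfun f -> bounded_mfun g ->
  (forall x, f x <= g x) -> \int[P]_x f x <= \int[P]_x g x.
Proof.
by move=> bf bg fg; apply: le_Rintegral => //; exact: bounded_mfun_integrable.
Qed.

Lemma prob_Rintegral_sum I (r : seq I) (F : I -> T -> R) : (forall i, bounded_mfun (F i)) ->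
  \int[P]_x (\sum_(i <- r) F i x) = \sum_(i <- r) \int[P]_x F i x.
Proof.
move=> bF; elim: r => [|i r IHr].
  by under eq_Rintegral do rewrite big_nil; rewrite prob_Rintegral_cst big_nil.
under eq_Rintegral do rewrite big_cons.
by rewrite prob_RintegralD// ?IHr ?big_cons//; exact: bounded_mfun_sum.
Qed.

Lemma prob_Rintegral_itv f lo hi : measurable_fun [set: T] f ->
  (forall x, lo <= f x <= hi) -> lo <= \int[P]_x f x <= hi.
Proof.
move=> mf fb; have bf := bounded_mfun_itv mf fb.
apply/andP; split.
- rewrite -[leLHS](prob_Rintegral_cst lo); apply: prob_le_Rintegral (bounded_mfun_cst _) bf _ => x.
  by case/andP: (fb x).
- rewrite -[leRHS](prob_Rintegral_cst hi); apply: prob_le_Rintegral bf (bounded_mfun_cst _) _ => x.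
  by case/andP: (fb x).
Qed.

End expectation.

End bounded_measurable.

Section fubini_bounded.
Context {d1 d2 : measure_display} {T1 : measurableType d1}
  {T2 : measurableType d2} {R : realType}.
Variables (P1 : probability T1 R) (P2 : probability T2 R).

Lemma bounded_mfun_pair1 (G : T1 * T2 -> R) x : bounded_mfun G ->
  bounded_mfun (fun y => G (x, y)).
Proof.
move=> [mG [M GM]]; split; last by exists M.
by apply: measurableT_comp mG _; exact: pair1_measurable.
Qed.

Let inner_EFin (G : T1 * T2 -> R) : bounded_mfun G ->
  (fun x => (\int[P2]_y G (x, y))%:E) = (fun x => \int[P2]_y (G (x, y))%:E)%E.
Proof.
move=> bG; apply/funext => x; rewrite EFin_Rintegral//.
exact: bounded_mfun_pair1.
Qed.

Lemma bounded_mfun_Rintegral (G : T1 * T2 -> R) : bounded_mfun G ->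
  bounded_mfun (fun x => \int[P2]_y G (x, y)).
Proof.
move=> bG; have [mG [M GM]] := bG.
have mI : measurable_fun [set: T1] (fun x => \int[P2]_y G (x, y)).
  apply/measurable_EFinP; rewrite /comp inner_EFin//.
  exact: measurable_fubini_F (bounded_mfun_integrable (P1 \x P2)%E bG).
apply: (@bounded_mfun_itv _ _ _ _ (- M) M) => // x.
apply: prob_Rintegral_itv; first by case: (bounded_mfun_pair1 x bG).
by move=> y; rewrite -ler_norml.
Qed.

Lemma Rintegral_prod (G : T1 * T2 -> R) : bounded_mfun G ->
  \int[(P1 \x P2)%E]_z G z = \int[P1]_x \int[P2]_y G (x, y).
Proof.
move=> bG; apply: EFin_inj; rewrite !EFin_Rintegral//; last exact: bounded_mfun_Rintegral.
rewrite -(integral12_prod_meas1 (bounded_mfun_integrable (P1 \x P2)%E bG)).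
by rewrite inner_EFin.
Qed.

End fubini_bounded.

Section hellinger.
Context {R : realType}.

(** By Cauchy-Schwarz the right-hand side is at least twice the affinity
    ∫ sqrt (dP dQ), with equality for g = sqrt (dQ / dP): the condition says that half the
    squared Hellinger distance of P and Q is at most delta. This form mentions no
    density and can be tensorised by integrating out one factor. *)
Definition hellinger_le disp (T : measurableType disp) (P Q : probability T R)
    (delta : R) :=
  forall (g : T -> R) (lo hi : R), measurable_fun [set: T] g ->
    0 < lo -> (forall x, lo <= g x <= hi) ->
    2 - 2 * delta <= \int[P]_x g x + \int[Q]_x (g x)^-1.

(** Integrating out the second factor turns G and 1/G into functions g and h of the
    first one. The bound on the second factor, in scale-invariant form, reads
    g h >= (1 - delta2)^2 when delta2 < 1, and the bound on the first one, applied to g, then gives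
    2 (1 - delta1) (1 - delta2) >= 2 - 2 (delta1 + delta2). *)
Lemma hellinger_le_prod d1 d2 (T1 : measurableType d1) (T2 : measurableType d2)
    (P1 Q1 : probability T1 R) (P2 Q2 : probability T2 R) (delta1 delta2 : R) :
  0 <= delta1 -> 0 <= delta2 ->
  hellinger_le P1 Q1 delta1 -> hellinger_le P2 Q2 delta2 ->
  hellinger_le (P1 \x P2)%E (Q1 \x Q2)%E (delta1 + delta2).
Proof.
move=> d10 d20 H1 H2 G lo hi mG lo0 Gb.
have bG := bounded_mfun_itv mG Gb.
have bGV := bounded_mfun_inv lo0 mG Gb.
have G0 z : 0 < G z by have /andP[+ _] := Gb z; exact: lt_le_trans.
rewrite !Rintegral_prod//.
pose g x := \int[P2]_y G (x, y); pose h x := \int[Q2]_y (G (x, y))^-1.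
have bg : bounded_mfun g := bounded_mfun_Rintegral P1 P2 bG.
have bh : bounded_mfun h := bounded_mfun_Rintegral Q1 Q2 bGV.
have mGx x : measurable_fun [set: T2] (fun y => G (x, y)).
  by case: (bounded_mfun_pair1 x bG).
have gb x : lo <= g x <= hi by apply: prob_Rintegral_itv => // y.
have g0 x : 0 < g x by have /andP[+ _] := gb x; exact: lt_le_trans.
have h0 x : 0 <= h x by apply: Rintegral_ge0 => y _; rewrite invr_ge0 ltW.
rewrite -/g -/h.
have [rho0|rho0] := lerP (1 - delta2) 0.
  have : 0 <= \int[P1]_x g x by apply: Rintegral_ge0 => x _; rewrite ltW.
  have : 0 <= \int[Q1]_x h x by exact: Rintegral_ge0.
  by rewrite mulrDr; lra.
set r := 1 - delta2 in rho0.
(* the additive bound for the rescaled function t G(x, .) reads t g + h / t >= 2 r;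
     the choice t = r / g x makes the first summand equal to r *)
have hg x : r ^+ 2 * (g x)^-1 <= h x.
  pose t := r / g x; have t0 : 0 < t by exact: divr_gt0.
  have := H2 (fun y => t * G (x, y)) (t * lo) (t * hi).
  rewrite prob_RintegralZ; last exact: bounded_mfun_pair1.
  have -> : \int[Q2]_y (t * G (x, y))^-1 = t^-1 * h x.
    rewrite -prob_RintegralZ; last exact: bounded_mfun_pair1 x bGV.
    by apply: eq_Rintegral => y _; rewrite invfM.
  rewrite -/(g x) -/(h x) /t divfK ?gt_eqF// => H.
  have {H} : 2 - 2 * delta2 <= r + (r / g x)^-1 * h x.
    apply: H.
    - by apply: measurable_funM => //; exact: mGx.
    - by rewrite mulr_gt0.
    - by move=> y; have /andP[? ?] := Gb (x, y); rewrite !ler_pM2l//; apply/andP.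
  have -> : 2 - 2 * delta2 = r + r by rewrite /r; ring.
  rewrite lerD2l => H.
  have -> : h x = r / g x * ((r / g x)^-1 * h x) by rewrite mulVKf// gt_eqF.
  by rewrite expr2 mulrAC ler_pM2l.
have mg : measurable_fun [set: T1] g by case: bg.
have bgV := bounded_mfun_inv lo0 mg gb.
have := H1 (fun x => r^-1 * g x) (r^-1 * lo) (r^-1 * hi).
rewrite prob_RintegralZ//.
have -> : \int[Q1]_x (r^-1 * g x)^-1 = r * \int[Q1]_x (g x)^-1.
  by rewrite -prob_RintegralZ//; apply: eq_Rintegral => x _; rewrite invfM invrK.
move=> H.
have {}H : 2 - 2 * delta1 <= r^-1 * \int[P1]_x g x + r * \int[Q1]_x (g x)^-1.
  apply: H.
  - exact: measurable_funM.
  - by rewrite mulr_gt0// invr_gt0.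
  - by move=> x; rewrite !ler_pM2l ?invr_gt0//; exact: gb.
have hQ : r ^+ 2 * \int[Q1]_x (g x)^-1 <= \int[Q1]_x h x.
  by rewrite -prob_RintegralZ//; apply: prob_le_Rintegral => //; exact: bounded_mfunZ.
apply: (@le_trans _ _ (r * (2 - 2 * delta1))); first by rewrite /r; nra.
apply: (le_trans (ler_wpM2l (ltW rho0) H)).
by rewrite mulrDr mulVKf ?gt_eqF// mulrA -expr2 lerD2l.
Qed.

Lemma hellinger_le_iid disp (T : measurableType disp) (P Q : probability T R)
    (delta : R) n : 0 <= delta -> hellinger_le P Q delta ->
  hellinger_le (iid_prob P n) (iid_prob Q n) (n%:R * delta).
Proof.
move=> d0 PQ; elim: n => [|n IHn] g lo hi mg lo0 gb.
  have mgV : measurable_fun setT (fun t => (g t)^-1).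
    by case: (bounded_mfun_inv lo0 mg gb).
  rewrite /Rintegral/= !integral_dirac//; [|exact/measurable_EFinP..].
  rewrite !diracT !mul1e/= mul0r mulr0 subr0.
  have : 0 < g [tuple] by have /andP[+ _] := gb [tuple]; exact: lt_le_trans.
  set y := g _ => y0.
  rewrite -subr_ge0.
  have -> : y + y^-1 - 2 = (y - 1) ^+ 2 * y^-1 by field; rewrite gt_eqF.
  by rewrite mulr_ge0 ?sqr_ge0// invr_ge0 ltW.
have mc := @measurable_cons_tuple _ T n.
have push (P' : probability T R) (f : n.+1.-tuple T -> R) : bounded_mfun f ->
    \int[iid_prob P' n.+1]_t f t =
    \int[(P' \x iid_prob P' n)%E]_z f (Defs.cons_tuple z).
  move=> [mf [M fM]]; rewrite /Rintegral; congr fine.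
  rewrite [LHS]integral_distribution//; first exact/measurable_EFinP.
  apply: (@bounded_mfun_integrable _ _ _ (P' \x iid_prob P' n)%E (f \o @Defs.cons_tuple _ _ n)).
  by split; [exact: measurableT_comp mf mc|exists M => z; exact: fM].
rewrite !push; [|exact: bounded_mfun_inv gb|exact: bounded_mfun_itv gb].
rewrite (_ : n.+1%:R * delta = delta + n%:R * delta); last by rewrite -[n.+1]add1n natrD; ring.
exact: (hellinger_le_prod d0 (mulr_ge0 (ler0n _ _) d0) PQ IHn
  (measurableT_comp mg mc) lo0 (fun z => gb _)).
Qed.

(** Test [hellinger_le] with g = sqrt (1 + k^2 f^2) - k f, whose inverse is
    sqrt (1 + k^2 f^2) + k f, and use sqrt (1 + y) <= 1 + y / 2. *)
Lemma hellinger_le_diff disp (T : measurableType disp) (P Q : probability T R)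
    (delta k : R) (f : T -> R) : hellinger_le P Q delta -> bounded_mfun f ->
  k * (\int[P]_x f x - \int[Q]_x f x) <=
  2 * delta + k ^+ 2 / 2 * (\int[P]_x f x ^+ 2 + \int[Q]_x f x ^+ 2).
Proof.
move=> PQ bf; have [mf [M fM]] := bf.
pose r x := Num.sqrt (1 + (k * f x) ^+ 2).
have r2 x : r x ^+ 2 = 1 + (k * f x) ^+ 2 by rewrite sqr_sqrtr// addr_ge0// sqr_ge0.
have r0 x : 0 <= r x by exact: sqrtr_ge0.
have rf x : `|k * f x| < r x.
  rewrite -(ltr_pXn2r (n := 2))// ?nnegrE// r2 real_normK ?num_real//; lra.
have mr : measurable_fun [set: T] r.
  apply: measurableT_comp.
    by apply: continuous_measurable_fun; exact: sqrt_continuous.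
  by apply: measurable_funD => //; apply: measurable_funX; exact: measurable_funM.
(* since |k f| < r <= 1 + |k f|, this C bounds both g and its inverse *)
pose C := 1 + 2 * (`|k| * M).
have M0 : 0 <= `|k| * M by rewrite mulr_ge0// (le_trans _ (fM point)).
have kfM x : `|k * f x| <= `|k| * M by rewrite normrM ler_wpM2l.
have rle x : r x <= 1 + `|k| * M.
  rewrite -(ler_pXn2r (n := 2))// ?nnegrE ?addr_ge0// r2.
  by have := kfM x; have := normr_ge0 (k * f x); rewrite -(real_normK (num_real (k * f x))); nra.
pose g x := r x - k * f x.
have gV x : (g x)^-1 = r x + k * f x.
  have g0 : g x != 0 by rewrite gt_eqF// subr_gt0 (le_lt_trans _ (rf x))// ler_norm.
  apply: (mulfI g0); rewrite divff// /g -subr_sqr r2; ring.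
have C0 : 0 < C by rewrite /C; lra.
have gb x : C^-1 <= g x <= C.
  have h1 := rle x; have h2 := kfM x; have h3 := ler_norm (k * f x).
  have h4 : - (k * f x) <= `|k * f x| by rewrite -normrN ler_norm.
  apply/andP; split; last by rewrite /g /C; lra.
  rewrite -[leRHS]invrK lef_pV2 ?posrE// ?gV; last first.
    by have := rf x; rewrite ltr_norml; lra.
  by rewrite /C; lra.
have mg : measurable_fun [set: T] g.
  by apply: measurable_funB => //; exact: measurable_funM.
have br : bounded_mfun r.
  by apply: (@bounded_mfun_itv _ _ _ _ 0 (1 + `|k| * M)) => // x; rewrite r0 rle.
have bkf := bounded_mfunZ k bf.
have bf2 := bounded_mfunX 2 bf.
have rsum (P' : probability T R) :
    \int[P']_x r x <= 1 + k ^+ 2 / 2 * \int[P']_x f x ^+ 2.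
  rewrite -prob_RintegralZ// -[X in X + _](@prob_Rintegral_cst _ _ _ P' 1) -prob_RintegralD//; first last.
  - exact: bounded_mfunZ.
  - exact: bounded_mfun_cst.
  apply: prob_le_Rintegral => //.
    by apply: bounded_mfunD; [exact: bounded_mfun_cst|exact: bounded_mfunZ].
  move=> x; rewrite -(ler_pXn2r (n := 2))// ?nnegrE//; last first.
    by rewrite addr_ge0// mulr_ge0 ?sqr_ge0// divr_ge0// sqr_ge0.
  rewrite r2 -subr_ge0.
  have -> : (1 + k ^+ 2 / 2 * f x ^+ 2) ^+ 2 - (1 + (k * f x) ^+ 2) =
    (k ^+ 2 / 2 * f x ^+ 2) ^+ 2 by field.
  exact: sqr_ge0.
have := PQ g C^-1 C mg; rewrite invr_gt0 => /(_ C0 gb).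
have -> : \int[Q]_x (g x)^-1 = \int[Q]_x (r x + k * f x).
  by apply: eq_Rintegral => x _; rewrite gV.
rewrite prob_RintegralB// prob_RintegralD// !prob_RintegralZ//.
have := rsum P; have := rsum Q; nra.
Qed.

End hellinger.

(** * Logistic labels *)

Section sigmoid_theory.
Context {R : realType}.
Implicit Types a b u w x : R.

Lemma sigmoid_gt0 x : 0 < sigmoid x.
Proof. by rewrite invr_gt0 addr_gt0// expR_gt0. Qed.

Lemma sigmoid_lt1 x : 1 - sigmoid x = expR (- x) * sigmoid x.
Proof.
rewrite /sigmoid; have := expR_gt0 (- x) => e0.
by field; rewrite gt_eqF// addr_gt0.
Qed.

Lemma sigmoid_le a b : a <= b -> sigmoid a <= sigmoid b.
Proof.
move=> ab; rewrite /sigmoid lef_pV2 ?posrE ?addr_gt0 ?expR_gt0//.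
by rewrite lerD2l ler_expR lerN2.
Qed.

Lemma is_derive_sigmoid x :
  is_derive x (1 : R) (@sigmoid R) (sigmoid x * (1 - sigmoid x)).
Proof.
have e0 : 1 + expR (- x) != 0 by rewrite gt_eqF// addr_gt0// expR_gt0.
have dN : is_derive x (1 : R) (fun y : R => 1 + expR (- y)) (- expR (- x)).
  have -> : (fun y : R => 1 + expR (- y)) = cst 1 + (expR \o -%R) by [].
  by apply: is_derive_eq; rewrite add0r ?mulrN1 ?mulrN ?mulr1.
have := @is_deriveV R (fun y => 1 + expR (- y)) x _ 1 e0 dN.
move=> /is_derive_eq; apply.
rewrite sigmoid_lt1 /sigmoid -[_ *: _]/(_ * _); field.
exact: e0.
Qed.

(** The derivative is p (1 - p) with p = sigmoid x, and p (1 - p) <= 1/4. *)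
Lemma sigmoid_lipschitz a b : a <= b -> sigmoid b - sigmoid a <= (b - a) / 4.
Proof.
rewrite le_eqVlt => /predU1P[->|ab]; first by rewrite !subrr mul0r.
have [||c _ ->] := @MVT R (@sigmoid R) (fun x => sigmoid x * (1 - sigmoid x)) a b ab.
- by move=> x _; exact: is_derive_sigmoid.
- apply: continuous_subspaceT => x.
  by apply/differentiable_continuous/derivable1_diffP; case: (is_derive_sigmoid x).
- rewrite mulrC ler_pM2l ?subr_gt0// -subr_ge0.
  have -> : 4^-1 - sigmoid c * (1 - sigmoid c) = (sigmoid c - 2^-1) ^+ 2 by field.
  exact: sqr_ge0.
Qed.

Lemma mul_sigmoid_gap (beta : R) w u : 0 <= beta ->
  u * (sigmoid (beta * (w + u)) - sigmoid (beta * (w - u))) =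
  `|u| * (sigmoid (beta * (w + `|u|)) - sigmoid (beta * (w - `|u|))).
Proof.
move=> b0; have [u0|u0] := lerP 0 u; first by rewrite ger0_norm.
by rewrite ltr0_norm// opprK; ring.
Qed.

(** With p = q exp l, the arithmetic-geometric mean inequality bounds the right-hand side
    below by 2 sqrt (p q). That number is both 2 p exp (- l / 2) >= p (2 - l) and
    2 q exp (l / 2) >= q (2 + l); take the average of the two. *)
Lemma tilted_sum_ge (p q g l : R) : 0 < q -> 0 < g -> p = q * expR l ->
  p + q - (p - q) * l / 2 <= p * g + q / g.
Proof.
move=> q0 g0 pE; pose E := expR (l / 2).
have E0 : 0 < E by exact: expR_gt0.
have lE : expR l = E ^+ 2 by rewrite expr2 -expRD; congr expR; field.
have amgm : 2 * (q * E) <= p * g + q / g.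
  rewrite -subr_ge0 pE lE.
  have -> : q * E ^+ 2 * g + q / g - 2 * (q * E) = q / g * (E * g - 1) ^+ 2.
    by field; rewrite gt_eqF.
  by rewrite mulr_ge0 ?sqr_ge0// divr_ge0// ltW.
apply: le_trans amgm.
have h1 : q * (1 + l / 2) <= q * E by rewrite ler_pM2l// expR_ge1Dx.
have h2 : p * (1 - l / 2) <= q * E.
  have : 1 - l / 2 <= E^-1 by rewrite /E -expRN expR_ge1Dx.
  rewrite pE lE -mulrA ler_pM2l// expr2 -mulrA => /(ler_wpM2l (ltW E0)).
  move=> /(ler_wpM2l (ltW E0)).
  by rewrite divff ?gt_eqF// mulr1.
by lra.
Qed.

(** Sum [tilted_sum_ge] over the two labels. The log-likelihood ratios of the labels
    differ by a - b, so the loss terms add up to half the symmetrised Kullback-Leibler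
    divergence (a - b) (sigmoid a - sigmoid b) of the two label laws. *)
Lemma label_hellinger (a b g1 g0 : R) : 0 < g1 -> 0 < g0 ->
  2 <= sigmoid a * g1 + (1 - sigmoid a) * g0 +
       (sigmoid b * g1^-1 + (1 - sigmoid b) * g0^-1) +
       (a - b) * (sigmoid a - sigmoid b) / 2.
Proof.
move=> g10 g00.
have A0 : 0 < 1 + expR (- a) by rewrite addr_gt0// expR_gt0.
have B0 : 0 < 1 + expR (- b) by rewrite addr_gt0// expR_gt0.
pose l := ln (1 + expR (- b)) - ln (1 + expR (- a)).
have lE : expR l = (1 + expR (- b)) / (1 + expR (- a)).
  by rewrite /l expRD [expR (- ln _)]expRN !lnK ?posrE.
have e1 : sigmoid a = sigmoid b * expR l.
  by rewrite lE /sigmoid mulKf// gt_eqF.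
have e0 : 1 - sigmoid a = (1 - sigmoid b) * expR (l - a + b).
  rewrite !sigmoid_lt1 e1 -addrA addrC !expRD expRN.
  have -> : expR (- b) = (expR b)^-1 by rewrite expRN.
  have := expR_gt0 b => eb; rewrite -expRN.
  by field; rewrite gt_eqF.
have := tilted_sum_ge (sigmoid_gt0 b) g10 e1.
have b1 : 0 < 1 - sigmoid b by rewrite sigmoid_lt1 mulr_gt0 ?expR_gt0 ?sigmoid_gt0.
have := tilted_sum_ge b1 g00 e0.
lra.
Qed.

End sigmoid_theory.

(** * One observation of the logistic model *)

Section one_sample.
Context {R : realType}.
Implicit Types (c s u w : R).

(** Up to a constant, the information that one observation carries per unit of squared
    distance between parameters: quadratic in beta for weak signals, linear for strong
    ones. *)
Definition information_rate (beta : R) :=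
  beta * Num.min beta (2 * Num.sqrt (2 / pi)).

Lemma information_rate_ge0 (beta : R) : 0 < beta -> 0 <= information_rate beta.
Proof.
by move=> b0; rewrite mulr_ge0 ?(ltW b0)// le_min ltW//= mulr_ge0// sqrtr_ge0.
Qed.

Lemma normal_peak1E : 2 * Num.sqrt (2 / pi) = 4 * normal_peak 1 :> R.
Proof.
have pi0 := @pi_gt0 R.
apply/eqP; rewrite -(eqrXn2 (n := 2)) ?mulr_ge0 ?sqrtr_ge0 ?normal_peak_ge0//.
have -> : (4 * normal_peak 1) ^+ 2 = 4 ^+ 2 / (pi * 2) :> R.
  by rewrite exprMn exprVn expr1n mul1r -[pi *+ 2]mulr_natr sqr_sqrtr// ltW ?mulr_gt0.
rewrite exprMn sqr_sqrtr ?divr_ge0 ?ltW//.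
by move: (@pi R) pi0 => p p0; apply/eqP; field; rewrite gt_eqF.
Qed.

Lemma measurable_sigmoid_affine (a b : R) :
  measurable_fun [set: R] (fun w => sigmoid (a * w + b)).
Proof. exact: (measurableT_comp measurable_sigmoid (measurable_affine_fun a b)). Qed.

(** A shift by u / s of the standard normal variable, applied to the [0, 1]-valued
    function w |-> sigmoid (beta s w). *)
Lemma integral_sigmoid_gap (beta s u : R) : 0 < beta -> 0 < s -> 0 <= u ->
  (\int[std_normal]_w
     (sigmoid (beta * (s * w + u)) - sigmoid (beta * (s * w - u)))%:E <=
   (2 * (u / s) * normal_peak 1)%:E)%E.
Proof.
move=> b0 s0 u0; pose G w : R := sigmoid (beta * s * w).
have us0 : 0 <= u / s by rewrite divr_ge0// ltW.
have mGc (t : R) : measurable_fun [set: R] (fun w => G (w + t)).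
  have := measurable_sigmoid_affine (beta * s) (beta * s * t).
  by apply: eq_measurable_fun => w _; rewrite /G mulrDr.
have GE (t w : R) : sigmoid (beta * (s * w + t)) = G (w + t / s).
  by rewrite /G; congr sigmoid; field; rewrite gt_eqF.
have G01 w : 0 <= G w <= 1 by exact: sigmoid_itv.
have mG : measurable_fun [set: R] G.
  by have := mGc 0; apply: eq_measurable_fun => w _; rewrite addr0.
have := std_normal_shift_gap us0 mG G01.
have fin : (\int[std_normal]_w (G (w - u / s))%:E)%E \is a fin_num.
  apply: integrable_fin_num => //; apply: bounded_mfun_integrable.
  exact: bounded_mfun_itv (mGc _) (fun w => G01 _).
have -> : (\int[std_normal]_w (G (w + u / s))%:E =
    \int[std_normal]_w (G (w - u / s))%:E +
    \int[std_normal]_w (sigmoid (beta * (s * w + u)) - sigmoid (beta * (s * w - u)))%:E)%E.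
  rewrite -ge0_integralD//.
  - by apply: eq_integral => w _; rewrite !GE mulNr -EFinD [in RHS]addrC subrK.
  - by move=> w _; rewrite lee_fin; case/andP: (G01 (w - u / s)).
  - by apply/measurable_EFinP; exact: mGc.
  - by move=> w _; rewrite lee_fin subr_ge0 sigmoid_le// ler_pM2l//; lra.
  - apply/measurable_EFinP; apply: measurable_funB.
    + by apply: eq_measurable_fun (mGc (u / s)) => w _; rewrite GE.
    + by apply: eq_measurable_fun (mGc (- u / s)) => w _; rewrite GE.
by rewrite leeD2lE.
Qed.

(** Half the symmetrised Kullback-Leibler divergence of the label laws with logits
    beta (p.2 + c p.1) and beta (p.2 - c p.1). *)
Definition half_sym_kl (beta c : R) (p : R * R) : R :=
  beta * (c * p.1 *
    (sigmoid (beta * (p.2 + c * p.1)) - sigmoid (beta * (p.2 - c * p.1)))).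

Lemma half_sym_kl_abs (beta c z w : R) : 0 <= beta ->
  half_sym_kl beta c (z, w) =
  beta * (`|c * z| *
    (sigmoid (beta * (w + `|c * z|)) - sigmoid (beta * (w - `|c * z|)))).
Proof. by move=> b0; rewrite /half_sym_kl/= mul_sigmoid_gap. Qed.

Lemma half_sym_kl_ge0 (beta c : R) p : 0 <= beta -> 0 <= half_sym_kl beta c p.
Proof.
move=> b0; case: p => z w; rewrite half_sym_kl_abs//.
rewrite !mulr_ge0// subr_ge0 sigmoid_le// ler_wpM2l//.
by have := normr_ge0 (c * z); lra.
Qed.

Lemma measurable_half_sym_kl (beta c : R) :
  measurable_fun [set: R * R] (half_sym_kl beta c).
Proof.
have m1 : measurable_fun [set: R * R] (fun p => c * p.1).
  by apply: measurable_funM => //; exact: measurable_fst.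
apply: measurable_funM => //; apply: measurable_funM => //.
apply: measurable_funB; apply: (measurableT_comp measurable_sigmoid);
  apply: measurable_funM => //.
  by apply: measurable_funD => //; exact: measurable_snd.
by apply: measurable_funB => //; exact: measurable_snd.
Qed.

(** Given the j-th coordinate z, the integrand is u = |c z| times a gap of the sigmoid
    over a window of half-width u. Its conditional mean is at most
    beta^2 u^2 / 2 by the Lipschitz bound, and at most
    2 beta u^2 / (s sqrt (2 pi)) by [integral_sigmoid_gap], with s = enorm theta. The hypothesis
    c^2 <= 1/3 makes s >= 4/5. Finally z^2 has mean at most 1. *)
Lemma std_gaussian_half_sym_kl (beta c : R) d (j : 'I_d) (theta : d.-tuple R) :
  0 < beta -> tnth theta j = 0 -> enorm theta ^+ 2 + c ^+ 2 = 1 ->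
  c ^+ 2 <= 3^-1 ->
  (\int[std_gaussian d]_x (half_sym_kl beta c (tnth x j, dotv x theta))%:E <=
   (5 / 8 * information_rate beta * c ^+ 2)%:E)%E.
Proof.
move=> b0 thj th1 c3; have b0' := ltW b0.
set s := enorm theta in th1 *; have sp : 0 <= s by exact: sqrtr_ge0.
have s0 : 4 / 5 <= s.
  have s45 : 0 <= 4 / 5 :> R by lra.
  rewrite -(ler_pXn2r (n := 2)) ?nnegrE// (_ : (4 / 5) ^+ 2 = 16 / 25); last by field.
  by lra.
have sgt0 : 0 < s by lra.
have mh := measurable_half_sym_kl beta c.
have mh' : measurable_fun setT (fun p => (half_sym_kl beta c p)%:E)
  by exact/measurable_EFinP.
have h0 p : (0 <= (half_sym_kl beta c p)%:E)%E by rewrite lee_fin half_sym_kl_ge0.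
rewrite (std_gaussian_coord_dotv thj mh' h0) -[enorm theta]/s.
set D := 5 / 8 * _ * _.
(* given z, the mean over w is at most D z^2 *)
have D0 : 0 <= D by rewrite mulr_ge0 ?sqr_ge0// mulr_ge0 ?information_rate_ge0//; lra.
have msq : measurable_fun [set: R] (fun z : R => (D * z ^+ 2)%:E).
  by apply/measurable_EFinP; apply: measurable_funM => //; exact: measurable_funX.
apply: (@le_trans _ _ (\int[std_normal]_z (D * z ^+ 2)%:E)%E); last first.
  under eq_integral do rewrite EFinM.
  rewrite ge0_integralZl//; last 2 first.
  - by apply/measurable_EFinP; exact: measurable_funX.
  - by move=> z _; rewrite lee_fin sqr_ge0.
  by rewrite -[leRHS]mule1 lee_wpmul2l// std_normal_sqr_le1.
apply: ge0_le_integral => //.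
- by move=> z _; apply: integral_ge0 => w _; exact: h0.
- apply: (@measurable_fun_fubini_tonelli_F _ _ _ _ _ std_normal
    (fun q : R * R => (half_sym_kl beta c (q.1, s * q.2))%:E)) => //.
  apply/measurable_EFinP; apply: measurableT_comp mh _.
  apply/measurable_fun_pairP; split; first exact: measurable_fst.
  by apply: measurable_funM => //; exact: measurable_snd.
move=> z _; set u := `|c * z|.
have u0 : 0 <= u by exact: normr_ge0.
have u2 : u ^+ 2 = c ^+ 2 * z ^+ 2 by rewrite real_normK ?num_real// exprMn.
have mgap : measurable_fun [set: R] (fun w =>
    sigmoid (beta * (s * w + u)) - sigmoid (beta * (s * w - u))).
  apply: measurable_funB.
    apply: eq_measurable_fun (measurable_sigmoid_affine (beta * s) (beta * u)) => w _.
    by congr sigmoid; ring.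
  apply: eq_measurable_fun (measurable_sigmoid_affine (beta * s) (- (beta * u))) => w _.
  by congr sigmoid; ring.
have gap0 w : 0 <= sigmoid (beta * (s * w + u)) - sigmoid (beta * (s * w - u)).
  by rewrite subr_ge0 sigmoid_le// ler_pM2l//; lra.
under eq_integral do rewrite half_sym_kl_abs// -/u mulrA EFinM.
rewrite ge0_integralZl//; last 3 first.
- exact/measurable_EFinP.
- by move=> w _; rewrite lee_fin.
- by rewrite lee_fin mulr_ge0.
have [bK|bK] := lerP beta (2 * Num.sqrt (2 / pi)).
- apply: (@le_trans _ _ ((beta * u)%:E * \int[std_normal]_w (beta * u / 2)%:E)%E).
    rewrite lee_wpmul2l ?lee_fin ?mulr_ge0//.
    apply: ge0_le_integral => //.
    - by move=> w _; rewrite lee_fin.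
    - exact/measurable_EFinP.
    move=> w _; rewrite lee_fin.
    have /sigmoid_lipschitz : beta * (s * w - u) <= beta * (s * w + u).
      by rewrite ler_pM2l//; lra.
    by move/le_trans; apply; rewrite le_eqVlt; apply/orP; left; apply/eqP; field.
  have bu0 : (0 <= (beta * u / 2)%:E)%E by rewrite lee_fin divr_ge0// mulr_ge0.
  rewrite (integral_std_normal_cst bu0).
  rewrite -EFinM lee_fin /D /information_rate min_l//.
  have -> : beta * u * (beta * u / 2) = beta ^+ 2 / 2 * u ^+ 2 by field.
  rewrite u2; have : 0 <= beta ^+ 2 * (c ^+ 2 * z ^+ 2).
    by apply: mulr_ge0; [|apply: mulr_ge0]; exact: sqr_ge0.
  lra.
- have := integral_sigmoid_gap b0 sgt0 u0.
  move=> /(@lee_wpmul2l _ (beta * u)%:E) => /(_ _)/le_trans; apply.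
    by rewrite lee_fin mulr_ge0.
  rewrite -EFinM lee_fin /D /information_rate min_r ?(ltW bK)// normal_peak1E.
  have p0 : 0 <= normal_peak 1 :> R by exact: normal_peak_ge0.
  have -> : beta * u * (2 * (u / s) * normal_peak 1) =
      2 * (beta * normal_peak 1 * u ^+ 2) * s^-1 by field; rewrite gt_eqF.
  rewrite u2.
  have -> : 5 / 8 * (beta * (4 * normal_peak 1)) * c ^+ 2 * z ^+ 2 =
      2 * (beta * normal_peak 1 * (c ^+ 2 * z ^+ 2)) * (5 / 4) by field.
  rewrite ler_wpM2l//; last by rewrite -[leRHS]invrK lef_pV2 ?posrE ?invr_gt0; lra.
  by apply: mulr_ge0 => //; apply: mulr_ge0; [exact: mulr_ge0|apply: mulr_ge0; exact: sqr_ge0].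
Qed.

(** Integrate [label_hellinger] over the covariate. *)
Lemma logistic_law_hellinger (beta c : R) d (j : 'I_d)
    (theta thetap thetam : d.-tuple R) :
  0 < beta -> tnth theta j = 0 -> enorm theta ^+ 2 + c ^+ 2 = 1 ->
  c ^+ 2 <= 3^-1 ->
  (forall x, dotv x thetap = dotv x theta + c * tnth x j) ->
  (forall x, dotv x thetam = dotv x theta - c * tnth x j) ->
  hellinger_le (logistic_law thetap beta) (logistic_law thetam beta)
    (5 / 16 * information_rate beta * c ^+ 2).
Proof.
move=> b0 thj th1 c3 pE mE g lo hi mg lo0 gb.
have g0 z : 0 < g z by have /andP[+ _] := gb z; exact: lt_le_trans.
have bg := bounded_mfun_itv mg gb.
have bgV := bounded_mfun_inv lo0 mg gb; have [mgV _] := bgV.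
pose mix (th : d.-tuple R) (f : d.-tuple R * bool -> R) (x : d.-tuple R) : R :=
  sigmoid (beta * dotv x th) * f (x, true) +
  (1 - sigmoid (beta * dotv x th)) * f (x, false).
have msig (th : d.-tuple R) : measurable_fun setT (fun x => sigmoid (beta * dotv x th)).
  apply: (measurableT_comp measurable_sigmoid).
  by apply: measurable_funM => //; exact: measurable_dotv_l.
have mmix (th : d.-tuple R) f : measurable_fun setT f -> measurable_fun setT (mix th f).
  move=> mf; apply: measurable_funD; apply: measurable_funM => //.
  - exact: (measurableT_comp mf (measurable_pair2 _)).
  - exact: measurable_funB.
  - exact: (measurableT_comp mf (measurable_pair2 _)).
have mix0 (th : d.-tuple R) f x : (forall z, 0 <= f z) -> 0 <= mix th f x.
  move=> f0; have /andP[? ?] := sigmoid_itv (beta * dotv x th).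
  by rewrite addr_ge0// mulr_ge0// subr_ge0.
have intE (th : d.-tuple R) f : bounded_mfun f -> (forall z, 0 <= f z) ->
    (\int[logistic_law th beta]_z f z)%:E = (\int[std_gaussian d]_x (mix th f x)%:E)%E.
  move=> bf f0; have [mf _] := bf; rewrite EFin_Rintegral// integral_logistic_law//.
  exact/measurable_EFinP.
have gV0 z : 0 <= (g z)^-1 by rewrite invr_ge0 ltW.
have g0' z : 0 <= g z by exact: ltW.
pose k x : R := half_sym_kl beta c (tnth x j, dotv x theta).
have k0 x : 0 <= k x by rewrite half_sym_kl_ge0// ltW.
have mk : measurable_fun setT k.
  apply: (measurableT_comp (measurable_half_sym_kl beta c)).
  by apply/measurable_fun_pairP; split; [exact: measurable_tnth|exact: measurable_dotv_l].
have conclude (A B I : R) (X Y : \bar R) : A%:E = X -> B%:E = Y ->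
    ((2 : R)%:E <= X + Y + (5 / 8 * I)%:E)%E -> 2 - 2 * (5 / 16 * I) <= A + B.
  by move=> <- <-; rewrite -!EFinD lee_fin; lra.
rewrite -mulrA; apply: (conclude _ _ _ _ _ (intE thetap g bg g0') (intE thetam _ bgV gV0)).
rewrite mulrA.
have kle := std_gaussian_half_sym_kl b0 thj th1 c3.
have m1 : measurable_fun setT (fun x => (mix thetap g x)%:E).
  by apply/measurable_EFinP; exact: mmix.
have m2 : measurable_fun setT (fun x => (mix thetam (fun z => (g z)^-1) x)%:E).
  by apply/measurable_EFinP; exact: mmix.
have m3 : measurable_fun setT (fun x => (k x)%:E) by exact/measurable_EFinP.
have p1 x : (0 <= (mix thetap g x)%:E)%E by rewrite lee_fin mix0.
have p2 x : (0 <= (mix thetam (fun z => (g z)^-1) x)%:E)%E by rewrite lee_fin mix0.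
have p3 x : (0 <= (k x)%:E)%E by rewrite lee_fin.
apply: (@le_trans _ _ (\int[std_gaussian d]_x (mix thetap g x)%:E +
    \int[std_gaussian d]_x (mix thetam (fun z => (g z)^-1) x)%:E +
    \int[std_gaussian d]_x (k x)%:E)%E); last exact: leeD2l kle.
rewrite -(ge0_integralD (std_gaussian d) measurableT (fun x _ => p1 x) m1 (fun x _ => p2 x) m2).
rewrite -(ge0_integralD (std_gaussian d) measurableT
  (fun x _ => adde_ge0 (p1 x) (p2 x)) (emeasurable_funD m1 m2) (fun x _ => p3 x) m3).
have -> : ((2 : R)%:E = \int[std_gaussian d]_x (2 : R)%:E)%E.
  by rewrite integral_cst//= [X in (_ * X)%E]probability_setT mule1.
apply: ge0_le_integral => //.
- exact: emeasurable_funD (emeasurable_funD m1 m2) m3.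
move=> x _; rewrite -!EFinD lee_fin.
have := @label_hellinger R (beta * dotv x thetap) (beta * dotv x thetam)
  _ _ (g0 (x, true)) (g0 (x, false)).
move/le_trans; apply; rewrite /mix lerD2l /k /half_sym_kl/= pE mE.
by rewrite le_eqVlt; apply/orP; left; apply/eqP; field.
Qed.

End one_sample.

(** * Geometry of the sphere *)

Section euclidean_geometry.
Context {R : realType}.

Lemma cauchy_schwarz (I : finType) (a b : I -> R) :
  (\sum_i a i * b i) ^+ 2 <= (\sum_i a i ^+ 2) * (\sum_i b i ^+ 2).
Proof.
have prod (f g : I -> R) :
    (\sum_i f i) * (\sum_i g i) = \sum_i \sum_j f i * g j.
  by rewrite mulr_suml; apply: eq_bigr => i _; rewrite mulr_sumr.
have : 0 <= \sum_i \sum_j (a i * b j - a j * b i) ^+ 2.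
  by apply: sumr_ge0 => i _; apply: sumr_ge0 => j _; exact: sqr_ge0.
have -> : \sum_i \sum_j (a i * b j - a j * b i) ^+ 2 =
    \sum_i \sum_j a i ^+ 2 * b j ^+ 2 + \sum_i \sum_j b i ^+ 2 * a j ^+ 2 -
    2 * \sum_i \sum_j (a i * b i) * (a j * b j).
  rewrite mulr_sumr -big_split -sumrB/=; apply: eq_bigr => i _.
  rewrite mulr_sumr -big_split -sumrB/=; apply: eq_bigr => j _.
  by ring.
rewrite -!prod expr2 [X in _ + X - _]mulrC; lra.
Qed.

Lemma enorm_subv_ge0 d (x y : d.-tuple R) : 0 <= enorm (subv x y).
Proof. exact: sqrtr_ge0. Qed.

Lemma enorm_subv_sqr d (x y : d.-tuple R) :
  enorm (subv x y) ^+ 2 = \sum_(i < d) (tnth x i - tnth y i) ^+ 2.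
Proof.
rewrite sqr_sqrtr ?dotv_ge0//; apply: eq_bigr => i _.
by rewrite !tnth_mktuple expr2.
Qed.

Lemma dotv_sphere d (x : d.-tuple R) : sphere x -> \sum_i tnth x i ^+ 2 = 1.
Proof.
rewrite /sphere/= => x1.
have : enorm x ^+ 2 = 1 by rewrite x1 expr1n.
by rewrite sqr_sqrtr ?dotv_ge0// => <-; apply: eq_bigr => i _; rewrite expr2.
Qed.

Lemma enorm_subv_sphere d (x y : d.-tuple R) : sphere x -> sphere y ->
  enorm (subv x y) ^+ 2 = 2 - 2 * dotv x y.
Proof.
move=> /dotv_sphere x1 /dotv_sphere y1; rewrite enorm_subv_sqr.
transitivity (\sum_i (tnth x i ^+ 2 + tnth y i ^+ 2 - 2 * (tnth x i * tnth y i))).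
  by apply: eq_bigr => i _; ring.
by rewrite sumrB big_split/= x1 y1 -mulr_sumr.
Qed.

Lemma dotv_sphere_sqr_le1 d (x y : d.-tuple R) : sphere x -> sphere y ->
  dotv x y ^+ 2 <= 1.
Proof.
move=> /dotv_sphere x1 /dotv_sphere y1.
by apply: le_trans (cauchy_schwarz (tnth x) (tnth y)) _; rewrite x1 y1 mulr1.
Qed.

(** The loss is sqrt (2 - 2 t) with t the correlation, and
    sqrt 2 (1 - t) (1 + t / 2) is a lower bound because
    (1 - t) (1 + t / 2)^2 = 1 - t^2 (3 + t) / 4 <= 1; 7/5 replaces sqrt 2. *)
Lemma enorm_subv_sphere_ge d (x y : d.-tuple R) : sphere x -> sphere y ->
  7 / 5 * (1 - (dotv x y + dotv x y ^+ 2) / 2) <= enorm (subv x y).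
Proof.
move=> sx sy; have := enorm_subv_sphere sx sy.
have := dotv_sphere_sqr_le1 sx sy; have := enorm_subv_ge0 x y.
move: (dotv x y) (enorm _) => t r r0 t1 r2.
have {}t1 : -1 <= t <= 1 by rewrite -ler_norml -(expr_le1 (n := 2)) ?real_normK ?num_real.
have /andP[tm1 tp1] := t1.
have [neg|pos] := lerP (1 - (t + t ^+ 2) / 2) 0.
  by apply: le_trans r0; rewrite pmulr_rle0//; lra.
rewrite -(ler_pXn2r (n := 2)) ?nnegrE//; last by rewrite mulr_ge0 ?ltW//; lra.
rewrite r2 -subr_ge0.
have -> : 2 - 2 * t - (7 / 5 * (1 - (t + t ^+ 2) / 2)) ^+ 2 =
    (1 - t) * (1 / 25 + 49 / 100 * (t ^+ 2 * (3 + t))).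
  by field.
apply: mulr_ge0; first lra.
have : 0 <= t ^+ 2 * (3 + t) by rewrite mulr_ge0 ?sqr_ge0//; lra.
lra.
Qed.

End euclidean_geometry.

(** * Hypercube of parameters *)

Section hypercube.
Context {m : nat}.
Local Notation V := {ffun 'I_m -> bool}.

Definition flip (j : 'I_m) (v : V) : V := [ffun i => if i == j then ~~ v i else v i].

Lemma flipK j : involutive (flip j).
Proof. by move=> v; apply/ffunP => i; rewrite !ffunE; case: eqP => // _; rewrite negbK. Qed.

Lemma flip_eq j v : flip j v j = ~~ v j.
Proof. by rewrite ffunE eqxx. Qed.

Lemma flip_neq j v i : i != j -> flip j v i = v i.
Proof. by move=> ij; rewrite ffunE (negbTE ij). Qed.

Context {R : realType}.

Definition sgb (b : bool) : R := if b then 1 else -1.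

Lemma sgbN b : sgb (~~ b) = - sgb b.
Proof. by case: b; rewrite /sgb/= ?opprK. Qed.

Lemma sgb_sqr b : sgb b ^+ 2 = 1.
Proof. by case: b; rewrite /sgb/= ?sqrrN expr1n. Qed.

(** Pair v with its neighbour across the j-th edge. The two signs are opposite and F is
    the same, so each pair contributes a difference of means of one function under
    two laws at small Hellinger distance. *)
Lemma sum_flip_le disp (T : measurableType disp) (P : V -> probability T R)
    (eta k : R) (j : 'I_m) (F : V -> T -> R) : 0 < k ->
  (forall v, hellinger_le (P v) (P (flip j v)) eta) ->
  (forall v, bounded_mfun (F v)) ->
  (forall v, F (flip j v) = F v) ->
  \sum_(v : V) sgb (v j) * \int[P v]_z F v z <=
  \sum_(v : V) (eta / k + k / 2 * \int[P v]_z F v z ^+ 2).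
Proof.
move=> k0 hP bF Fflip.
pose E v (f : T -> R) : R := \int[P v]_z f z.
pose S v := E v (F v); pose Q v := E v (fun z => F v z ^+ 2).
have flip_sum (g : V -> R) : \sum_v g (flip j v) = \sum_v g v.
  by rewrite [RHS](reindex_inj (inv_inj (flipK j))).
rewrite -[leLHS]/(\sum_(v : V) sgb (v j) * S v).
rewrite -[leRHS]/(\sum_(v : V) (eta / k + k / 2 * Q v)).
have step (v : V) : sgb (v j) * S v + sgb (flip j v j) * S (flip j v) <=
    (eta / k + k / 2 * Q v) + (eta / k + k / 2 * Q (flip j v)).
  have := hellinger_le_diff (k * sgb (v j)) (hP v) (bF v).
  rewrite -[\int[P v]_z F v z]/(S v) -[\int[P v]_z F v z ^+ 2]/(Q v).
  have -> : \int[P (flip j v)]_z F v z = S (flip j v) by rewrite /S Fflip.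
  have -> : \int[P (flip j v)]_z F v z ^+ 2 = Q (flip j v) by rewrite /Q Fflip.
  rewrite flip_eq sgbN exprMn sgb_sqr mulr1.
  move: (S v) (S (flip j v)) (Q v) (Q (flip j v)) (sgb (v j)) => a b c d s H.
  rewrite -(ler_pM2l k0).
  have -> : k * (eta / k + k / 2 * c + (eta / k + k / 2 * d)) =
    2 * eta + k ^+ 2 / 2 * (c + d) by field; rewrite gt_eqF.
  by apply: le_trans H; rewrite le_eqVlt; apply/orP; left; apply/eqP; ring.
have twice (g : V -> R) : \sum_v (g v + g (flip j v)) = 2 * \sum_v g v.
  by rewrite big_split/= flip_sum; ring.
rewrite -(ler_pM2l (@ltr0Sn R 1)) -2!twice.
by apply: ler_sum => v _; exact: step.
Qed.

End hypercube.

Section prior.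
Context {R : realType} {m : nat}.
Local Notation V := {ffun 'I_m -> bool}.
Variables (s : R) (m0 : (0 < m)%N) (s01 : 0 < s <= 1).
Implicit Types v : V.

Definition spacing : R := s / Num.sqrt m%:R.

Definition vertex v : m.+1.-tuple R :=
  Defs.cons_tuple (Num.sqrt (1 - s ^+ 2), [tuple spacing * sgb (v i) | i < m]).

(** The part of a vertex shared by both ends of its j-th edge. *)
Definition vertex_except j v : m.+1.-tuple R :=
  Defs.cons_tuple (Num.sqrt (1 - s ^+ 2),
    [tuple if i == j then 0 else spacing * sgb (v i) | i < m]).

Let m0R : (0 : R) < m%:R. Proof. by rewrite ltr0n. Qed.

Lemma spacing_gt0 : 0 < spacing.
Proof. by case/andP: s01 => s0 _; rewrite divr_gt0// sqrtr_gt0. Qed.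

Lemma spacing_sqr : spacing ^+ 2 = s ^+ 2 / m%:R.
Proof. by rewrite exprMn exprVn sqr_sqrtr// ltW. Qed.

Lemma dotv_vertex (x : m.+1.-tuple R) v : dotv x (vertex v) =
  tnth x ord0 * Num.sqrt (1 - s ^+ 2) +
  spacing * \sum_(i < m) sgb (v i) * tnth x (lift ord0 i).
Proof.
rewrite /dotv big_ord_recl tnth0; congr (_ + _).
by rewrite mulr_sumr; apply: eq_bigr => i _; rewrite tnthS tnth_mktuple; ring.
Qed.

Lemma dotv_vertex_except (x : m.+1.-tuple R) j v : dotv x (vertex v) =
  dotv x (vertex_except j v) + spacing * sgb (v j) * tnth x (lift ord0 j).
Proof.
rewrite /dotv !big_ord_recl !tnth0 -addrA; congr (_ + _).
rewrite (bigD1 j)//= [X in _ = X + _](bigD1 j)//= !tnthS !tnth_mktuple eqxx mulr0 add0r.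
rewrite addrC; congr (_ + _); last by rewrite mulrC.
apply: eq_bigr => i /negbTE ij; by rewrite !tnthS !tnth_mktuple ij.
Qed.

Lemma vertex_except_flip j v : vertex_except j (flip j v) = vertex_except j v.
Proof.
congr (Defs.cons_tuple (_, _)); apply: eq_from_tnth => i; rewrite !tnth_mktuple.
by case: eqP => // /eqP ij; rewrite flip_neq.
Qed.

Lemma vertex_sqr v : dotv (vertex v) (vertex v) = 1.
Proof.
rewrite dotv_vertex tnth0.
have -> : \sum_(i < m) sgb (v i) * tnth (vertex v) (lift ord0 i) = spacing * m%:R.
  transitivity (\sum_(i < m) spacing).
    apply: eq_bigr => i _; rewrite tnthS tnth_mktuple mulrCA -expr2 sgb_sqr.
    by rewrite mulr1.
  by rewrite sumr_const card_ord mulr_natr.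
rewrite -expr2 sqr_sqrtr; last first.
  by case/andP: s01 => s0 s1; rewrite subr_ge0 expr_le1// ltW.
rewrite mulrA -expr2 spacing_sqr divfK ?subrK// gt_eqF//.
Qed.

Lemma vertex_sphere v : sphere (vertex v).
Proof. by rewrite /sphere/= /enorm vertex_sqr sqrtr1. Qed.

Lemma vertex_except_sqr j v :
  enorm (vertex_except j v) ^+ 2 + (spacing * sgb (v j)) ^+ 2 = 1.
Proof.
have dotvC (x y : m.+1.-tuple R) : dotv x y = dotv y x.
  by apply: eq_bigr => i _; rewrite mulrC.
rewrite sqr_sqrtr ?dotv_ge0// -[RHS](vertex_sqr v).
rewrite (dotv_vertex_except _ j) dotvC (dotv_vertex_except _ j).
rewrite !tnthS !tnth_mktuple eqxx mulr0 addr0 expr2//.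
Qed.

Lemma vertex_hellinger (beta : R) j v : 0 < beta -> (3 <= m)%N ->
  hellinger_le (logistic_law (vertex v) beta)
    (logistic_law (vertex (flip j v)) beta)
    (5 / 16 * information_rate beta * (s ^+ 2 / m%:R)).
Proof.
move=> b0 m3.
have -> : s ^+ 2 / m%:R = (spacing * sgb (v j)) ^+ 2.
  by rewrite exprMn sgb_sqr mulr1 spacing_sqr.
apply: (@logistic_law_hellinger _ _ _ _ (lift ord0 j) (vertex_except j v)) => //.
- by rewrite tnthS tnth_mktuple eqxx.
- exact: vertex_except_sqr.
- rewrite exprMn sgb_sqr mulr1 spacing_sqr.
  have /andP[s0 s1] := s01.
  have s2 : s ^+ 2 <= 1 by rewrite expr_le1// ltW.
  rewrite ler_pdivrMr//; have : (3 : R) <= m%:R by rewrite (ler_nat R 3).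
  lra.
- by move=> x; exact: dotv_vertex_except.
- move=> x; rewrite (dotv_vertex_except x j) vertex_except_flip flip_eq sgbN.
  by rewrite mulrN mulNr.
Qed.

End prior.

(** * Lower bounds on the loss at a vertex *)

Section pointwise.
Context {R : realType} {m : nat}.
Local Notation V := {ffun 'I_m -> bool}.
Variable m0 : (0 < m)%N.

Definition clamp (x : R) : R := Num.max (- 1) (Num.min 1 x).

Lemma clamp_itv x : -1 <= clamp x <= 1.
Proof. by rewrite /clamp le_max lexx/= ge_max ge_min lexx/= andbT; lra. Qed.

(** The truncation moves x closer to the sign, and |y - e| = 1 - e y for a sign e and
    y in [-1, 1]. *)
Lemma clamp_dist b (x : R) : 1 - sgb b * clamp x <= `|x - sgb b|.
Proof.
have m11 : Num.max (- 1) 1 = 1 :> R by rewrite max_r//; lra.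
have n1 := ler_norm (x - 1); have n2 := ler_norm (x + 1).
have n3 := lerNnormlW (lexx `|x - 1|); have n4 := lerNnormlW (lexx `|x + 1|).
rewrite /clamp /sgb; have [x1|x1] := lerP 1 x; last have [x2|x2] := lerP (- 1) x;
  by rewrite ?m11; case: b; rewrite ?opprK; lra.
Qed.

(** The Euclidean distance dominates the l1 distance of the tail coordinates divided by
    sqrt m, and [clamp_dist] applies to each coordinate after division by the spacing. *)
Lemma vertex_dist_clamp (s : R) (v : V) (x : m.+1.-tuple R) : 0 < s <= 1 ->
  s * (1 - m%:R^-1 *
    \sum_(j < m) sgb (v j) * clamp (tnth x (lift ord0 j) / spacing (m := m) s)) <=
  enorm (subv x (vertex s v)).
Proof.
move=> s01; have c0 := spacing_gt0 m0 s01; set c := spacing s in c0 *.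
have m0R : (0 : R) < m%:R by rewrite ltr0n.
set r := enorm _; have r0 : 0 <= r by exact: enorm_subv_ge0.
pose a (j : 'I_m) := `|tnth x (lift ord0 j) - c * sgb (v j)|.
have a2 : \sum_j a j ^+ 2 <= r ^+ 2.
  rewrite enorm_subv_sqr big_ord_recl/= ler_wpDl ?sqr_ge0//.
  apply: ler_sum => j _; rewrite tnthS tnth_mktuple -/c.
  by rewrite /a real_normK ?num_real.
set q := Num.sqrt m%:R : R; have q2 : q ^+ 2 = m%:R by rewrite sqr_sqrtr// ltW.
have q0 : 0 < q by rewrite sqrtr_gt0.
have asum : \sum_j a j <= q * r.
  have as0 : 0 <= \sum_j a j by apply: sumr_ge0 => j _; exact: normr_ge0.
  have qr0 : 0 <= q * r by rewrite mulr_ge0// ltW.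
  rewrite -(ler_pXn2r (n := 2))// exprMn q2.
  have := cauchy_schwarz (fun=> 1) a.
  under eq_bigr do rewrite mul1r.
  rewrite expr1n sumr_const card_ord => /le_trans; apply.
  by rewrite ler_wpM2l// ltW.
have alow : c * (m%:R - \sum_j sgb (v j) * clamp (tnth x (lift ord0 j) / c)) <=
    \sum_j a j.
  have -> : m%:R = \sum_(j < m) (1 : R) by rewrite sumr_const card_ord.
  rewrite -sumrB mulr_sumr; apply: ler_sum => j _.
  apply: (le_trans (ler_wpM2l (ltW c0) (clamp_dist _ _))).
  rewrite /a -[X in X * _]gtr0_norm// -normrM mulrBr mulrCA divff ?gt_eqF//.
  by rewrite mulr1.
rewrite -(ler_pM2l q0); apply: le_trans asum; apply: le_trans alow.
set S := \sum_(j < m) _.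
have -> : c = s / q by [].
have -> : s / q * (m%:R - S) = q * (s * (1 - m%:R^-1 * S)).
  by rewrite -q2; field; rewrite gt_eqF.
exact: lexx.
Qed.

(** Coefficient of the j-th sign of v in t + t^2 - (diagonal), where t is the
    correlation of x with the vertex: expanding t^2 and splitting off one
    sign in each product leaves an expression that ignores the j-th sign. *)
Definition cross_term (v : V) (j : 'I_m) (x : m.+1.-tuple R) : R :=
  spacing (m := m) 1 * tnth x (lift ord0 j) *
  (1 + spacing (m := m) 1 * \sum_(i < m | i != j) sgb (v i) * tnth x (lift ord0 i)).

Lemma cross_term_flip v j x : cross_term (flip j v) j x = cross_term v j x.
Proof.
congr (_ * (1 + _ * _)); apply: eq_bigr => i ij; by rewrite flip_neq.
Qed.

Let m0R : (0 : R) < m%:R. Proof. by rewrite ltr0n. Qed.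

Let tail_le1 (x : m.+1.-tuple R) : sphere x ->
  \sum_(i < m) tnth x (lift ord0 i) ^+ 2 <= 1.
Proof. by move=> /dotv_sphere <-; rewrite [leRHS]big_ord_recl/= ler_wpDl// sqr_ge0. Qed.

Let spacing1_sqr : spacing (m := m) (1 : R) ^+ 2 = m%:R^-1.
Proof. by rewrite spacing_sqr// expr1n mul1r. Qed.

Let dotv_vertex1 (v : V) (x : m.+1.-tuple R) :
  dotv x (vertex 1 v) = spacing (m := m) 1 * \sum_(i < m) sgb (v i) * tnth x (lift ord0 i).
Proof. by rewrite dotv_vertex expr1n subrr sqrtr0 mulr0 add0r. Qed.

Lemma dotv_vertex_cross (v : V) (x : m.+1.-tuple R) : sphere x ->
  dotv x (vertex 1 v) + dotv x (vertex 1 v) ^+ 2 <=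
  m%:R^-1 + \sum_(j < m) sgb (v j) * cross_term v j x.
Proof.
move=> sx; rewrite dotv_vertex1; set c := spacing 1; set S := \sum_(i < m) _.
have -> : \sum_(j < m) sgb (v j) * cross_term v j x =
    c * S + (c * S) ^+ 2 - c ^+ 2 * \sum_(j < m) tnth x (lift ord0 j) ^+ 2.
  transitivity (\sum_(j < m) (c * (sgb (v j) * tnth x (lift ord0 j)) * (1 + c * S) -
      c ^+ 2 * tnth x (lift ord0 j) ^+ 2)).
    apply: eq_bigr => j _; rewrite /cross_term -/c.
    have -> : S = sgb (v j) * tnth x (lift ord0 j) +
      \sum_(i < m | i != j) sgb (v i) * tnth x (lift ord0 i) by rewrite /S (bigD1 j).
    set y := tnth x _; set U := \sum_(i < m | _) _.
    transitivity (c * (sgb (v j) * y) * (1 + c * (sgb (v j) * y + U)) -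
      c ^+ 2 * (sgb (v j) ^+ 2 * y ^+ 2)); first by ring.
    by rewrite sgb_sqr mul1r.
  rewrite sumrB -mulr_suml -!mulr_sumr -/S; ring.
have := tail_le1 sx; have -> : c ^+ 2 = m%:R^-1 by exact: spacing1_sqr.
move: (\sum_(j < m) _) (c * S) => U t U1.
have : m%:R^-1 * U <= m%:R^-1 by rewrite ler_piMr// invr_ge0 ltW.
lra.
Qed.

(** The inner sum is the correlation of x with a vector of norm at most 1, so the second
    factor is at most 2 in absolute value. *)
Lemma cross_term_sqr_sum (v : V) (x : m.+1.-tuple R) : sphere x ->
  \sum_(j < m) cross_term v j x ^+ 2 <= 4 / m%:R.
Proof.
move=> sx; have tl := tail_le1 sx.
have cross j : cross_term v j x ^+ 2 <= 4 / m%:R * tnth x (lift ord0 j) ^+ 2.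
  rewrite /cross_term; set c := spacing 1.
  have c2 : c ^+ 2 = m%:R^-1 by exact: spacing1_sqr.
  set U := \sum_(i < m | _) _.
  have cU : (c * U) ^+ 2 <= 1.
    rewrite exprMn c2 mulrC ler_pdivrMr// mul1r.
    pose a (i : 'I_m) : R := if i != j then sgb (v i) else 0.
    have -> : U = \sum_(i < m) a i * tnth x (lift ord0 i).
      rewrite /U big_mkcond; apply: eq_bigr => i _; rewrite /a.
      by case: ifP => // _; rewrite mul0r.
    apply: (le_trans (cauchy_schwarz _ _)).
    have a0 : 0 <= \sum_(i < m) a i ^+ 2 by apply: sumr_ge0 => i _; exact: sqr_ge0.
    apply: (@le_trans _ _ (\sum_(i < m) a i ^+ 2)); first by rewrite ler_piMr.
    have -> : m%:R = \sum_(i < m) (1 : R) by rewrite sumr_const card_ord.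
    apply: ler_sum => i _; rewrite /a; case: ifP => _; first by rewrite sgb_sqr.
    by rewrite expr0n/= ler01.
  have /andP[u1 u2] : -1 <= c * U <= 1.
    by rewrite -ler_norml -(expr_le1 (n := 2)) ?real_normK ?num_real.
  have h : (1 + c * U) ^+ 2 <= 4 by nra.
  rewrite exprMn [(c * _) ^+ 2]exprMn c2; set y2 := tnth _ _ ^+ 2.
  have : 0 <= m%:R^-1 * y2 by rewrite mulr_ge0 ?sqr_ge0// invr_ge0 ltW.
  move: h; move: ((1 + _) ^+ 2) => w h my0.
  by rewrite -mulrA mulrC; nra.
apply: (le_trans (ler_sum _ (fun j _ => cross j))).
by rewrite -mulr_sumr ler_piMr// divr_ge0// ltW.
Qed.

End pointwise.

(** * From the risk to the sample size *)

Section lower_bound.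
Context {R : realType} {m n : nat}.
Local Notation V := {ffun 'I_m -> bool}.
Local Notation data := (n.-tuple (m.+1.-tuple R * bool)).
Variables (beta eps : R) (thetahat : data -> m.+1.-tuple R).
Hypotheses (m3 : (3 <= m)%N) (beta0 : 0 < beta).
Hypothesis mthetahat : measurable_fun [set: data] thetahat.
Hypothesis sthetahat : forall z, sphere (thetahat z).
Hypothesis risk : forall theta : m.+1.-tuple R, sphere theta ->
  ('E_(iid_prob (logistic_law theta beta) n)
     [fun z => enorm (subv (thetahat z) theta)] <= eps%:E)%E.

Let m0 : (0 < m)%N. Proof. exact: leq_trans m3. Qed.
Let m0R : (0 : R) < m%:R. Proof. by rewrite ltr0n. Qed.

(** Bound on the Hellinger parameter between the laws of n observations at adjacent
    vertices. *)
Definition sample_hellinger s : R := n%:R * (5 / 16 * information_rate beta * (s ^+ 2 / m%:R)).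
Local Notation eta := sample_hellinger.

Let P s (v : V) := iid_prob (logistic_law (vertex s v) beta) n.

Let hellP s j v : 0 < s <= 1 -> hellinger_le (P s v) (P s (flip j v)) (eta s).
Proof.
move=> s01; apply: hellinger_le_iid; last exact: vertex_hellinger.
rewrite mulr_ge0 ?divr_ge0 ?sqr_ge0 ?(ltW m0R)// mulr_ge0 ?information_rate_ge0//.
Qed.

Let measurable_coord i : measurable_fun [set: data] (fun z => tnth (thetahat z) i).
Proof. exact: (measurableT_comp (measurable_tnth i) mthetahat). Qed.

Let coord_itv i z : -1 <= tnth (thetahat z) i <= 1.
Proof.
rewrite -ler_norml -(expr_le1 (n := 2)) ?real_normK ?num_real//.
have <- := dotv_sphere (sthetahat z).
by rewrite (bigD1 i)//= lerDl sumr_ge0// => j _; exact: sqr_ge0.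
Qed.

Let bounded_coord i : bounded_mfun (fun z => tnth (thetahat z) i).
Proof. exact: bounded_mfun_itv (measurable_coord i) (coord_itv i). Qed.

Let bounded_loss theta : sphere theta ->
  bounded_mfun (fun z => enorm (subv (thetahat z) theta)).
Proof.
move=> stheta; apply: (@bounded_mfun_itv _ _ _ _ 0 2).
  apply: (measurableT_comp (continuous_measurable_fun (@sqrt_continuous R))).
  apply: measurable_sum => i.
  have mi : measurable_fun [set: data] (fun z => tnth (subv (thetahat z) theta) i).
    under eq_fun do rewrite tnth_mktuple.
    exact: measurable_funB.
  exact: measurable_funM.
move=> z; rewrite enorm_subv_ge0/= -(ler_pXn2r (n := 2)) ?nnegrE ?enorm_subv_ge0//.
rewrite enorm_subv_sphere//.
have : `|dotv (thetahat z) theta| <= 1.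
  rewrite -(expr_le1 (n := 2)) ?real_normK ?num_real//.
  exact: dotv_sphere_sqr_le1.
by rewrite ler_norml; lra.
Qed.

Let vertex_risk s (v : V) (g : data -> R) : 0 < s <= 1 -> bounded_mfun g ->
  (forall z, g z <= enorm (subv (thetahat z) (vertex s v))) ->
  \int[P s v]_z g z <= eps.
Proof.
move=> s01 bg gle; have sv := vertex_sphere m0 s01 v.
have bl := bounded_loss sv.
apply: le_trans (prob_le_Rintegral (P s v) bg bl gle) _.
have := risk sv.
by rewrite unlock -(EFin_Rintegral _ bl) lee_fin.
Qed.

Let sum_vertices (c : R) : \sum_(v : V) c = c * #|V|%:R.
Proof. by rewrite sumr_const mulr_natr. Qed.

Let V0 : (0 : R) < #|V|%:R.
Proof. by rewrite ltr0n; apply/card_gt0P; exists [ffun=> true]. Qed.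

(** [sum_flip_le] for each coordinate, after exchanging the two sums. *)
Let average_le s (k b : R) (F : V -> 'I_m -> data -> R) : 0 < s <= 1 -> 0 < k ->
  (forall v j, bounded_mfun (F v j)) ->
  (forall v j, F (flip j v) j = F v j) ->
  (forall v z, \sum_(j < m) F v j z ^+ 2 <= b) ->
  \sum_(v : V) \int[P s v]_z (\sum_(j < m) sgb (v j) * F v j z) <=
  (m%:R * (eta s / k) + k / 2 * b) * #|V|%:R.
Proof.
move=> s01 k0 bF Fflip Fb.
have bF2 v j : bounded_mfun (fun z => F v j z ^+ 2) by exact: bounded_mfunX.
have -> : \sum_(v : V) \int[P s v]_z (\sum_(j < m) sgb (v j) * F v j z) =
    \sum_(j < m) \sum_(v : V) sgb (v j) * \int[P s v]_z F v j z.
  rewrite exchange_big/=; apply: eq_bigr => v _.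
  rewrite prob_Rintegral_sum; last by move=> j; exact: bounded_mfunZ.
  by apply: eq_bigr => j _; rewrite prob_RintegralZ.
apply: (@le_trans _ _ (\sum_(j < m) \sum_(v : V)
    (eta s / k + k / 2 * \int[P s v]_z F v j z ^+ 2))).
  apply: ler_sum => j _.
  exact: (sum_flip_le k0 (fun v => hellP j v s01) (fun v => bF v j) (fun v => Fflip v j)).
rewrite exchange_big/= -sum_vertices; apply: ler_sum => v _.
rewrite big_split/= sumr_const card_ord -[eta s / k *+ m]mulr_natl lerD2l.
rewrite -mulr_sumr ler_pM2l ?divr_gt0// -prob_Rintegral_sum//.
rewrite -[leRHS](prob_Rintegral_cst (P s v)); apply: prob_le_Rintegral => //.
- exact: bounded_mfun_sum.
- exact: bounded_mfun_cst.
Qed.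

(** At s = 2 eps the risk bound forces the average of the signed coordinates to be at
    least 1/2, while [average_le] with k = 1/2 bounds it by 2 eta + 1/4. *)
Lemma small_eps_bound : 0 < eps <= 2^-1 -> 8^-1 <= eta (2 * eps).
Proof.
move=> /andP[e0 e2]; have s01 : 0 < 2 * eps <= 1 by lra.
set s := 2 * eps in s01 *; set c := spacing (m := m) s.
pose f j z : R := clamp (tnth (thetahat z) (lift ord0 j) / c).
have bf j : bounded_mfun (f j).
  apply: (@bounded_mfun_itv _ _ _ _ (- 1) 1); last by move=> z; exact: clamp_itv.
  apply: measurable_maxr => //; apply: measurable_minr => //.
  exact: measurable_funM.
have bsum (v : V) : bounded_mfun (fun z => \sum_(j < m) sgb (v j) * f j z).
  by apply: bounded_mfun_sum => j; exact: bounded_mfunZ.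
have half0 : (0 : R) < 2^-1 by lra.
have avg := @average_le s 2^-1 m%:R (fun _ => f) s01 half0 (fun _ => bf) (fun _ _ => erefl).
have {}avg : \sum_(v : V) \int[P s v]_z (\sum_(j < m) sgb (v j) * f j z) <=
    (m%:R * (eta s / 2^-1) + 2^-1 / 2 * m%:R) * #|V|%:R.
  apply: avg => _ z.
  have -> : m%:R = \sum_(j < m) (1 : R) by rewrite sumr_const card_ord.
  apply: ler_sum => j _; have := clamp_itv (tnth (thetahat z) (lift ord0 j) / c).
  by rewrite -/(f j z) => /andP[? ?]; nra.
have low (v : V) : s * (1 - m%:R^-1 * \int[P s v]_z (\sum_(j < m) sgb (v j) * f j z)) <= eps.
  rewrite -prob_RintegralZ// -[X in X - _](prob_Rintegral_cst (P s v)) -prob_RintegralB//; last 2 first.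
  - exact: bounded_mfun_cst.
  - exact: bounded_mfunZ.
  rewrite -prob_RintegralZ; last by apply: bounded_mfunB; [exact: bounded_mfun_cst|exact: bounded_mfunZ].
  apply: vertex_risk => //.
    by apply: bounded_mfunZ; apply: bounded_mfunB; [exact: bounded_mfun_cst|exact: bounded_mfunZ].
  by move=> z; exact: vertex_dist_clamp.
have {low} : \sum_(v : V) (s - s / m%:R *
    \int[P s v]_z (\sum_(j < m) sgb (v j) * f j z)) <= eps * #|V|%:R.
  rewrite -sum_vertices; apply: ler_sum => v _; apply: le_trans (low v).
  by rewrite mulrBr mulr1 mulrA.
rewrite sumrB sum_vertices -mulr_sumr.
move: avg; move: (\sum_(v : V) _) #|V|%:R V0 => A N N0 avg low.
have [s0 _] := andP s01.
have : s / m%:R * A <= s * (2 * eta s + 4^-1) * N.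
  have -> : s * (2 * eta s + 4^-1) * N =
    s / m%:R * ((m%:R * (eta s / 2^-1) + 2^-1 / 2 * m%:R) * N).
    by move: (eta s) => x; field; rewrite gt_eqF.
  by rewrite ler_pM2l// divr_gt0.
move=> A_le; have : s * N - s * (2 * eta s + 4^-1) * N <= eps * N by lra.
rewrite -mulrBl ler_pM2r// /s; move: (eta _) => x H.
have : eps * (2 * (1 - (2 * x + 4^-1))) <= eps * 1 by lra.
by rewrite ler_pM2l//; lra.
Qed.

(** [average_le] with k = m / 16, for which the second-moment term is 1/8 by
    [cross_term_sqr_sum]. *)
Lemma large_eps_bound :
  7 / 5 * (1 - (m%:R^-1 + 16 * eta 1 + 8^-1) / 2) <= eps.
Proof.
have s01 : 0 < (1 : R) <= 1 by lra.
pose F (v : V) j z := cross_term v j (thetahat z).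
have bF v j : bounded_mfun (F v j).
  apply: bounded_mfunM; first exact: bounded_mfunZ.
  apply: bounded_mfunD; first exact: bounded_mfun_cst.
  apply: bounded_mfunZ; under eq_fun do rewrite big_mkcond.
  apply: bounded_mfun_sum => i; case: (i != j); first exact: bounded_mfunZ.
  exact: bounded_mfun_cst.
have bsum (v : V) : bounded_mfun (fun z => \sum_(j < m) sgb (v j) * F v j z).
  by apply: bounded_mfun_sum => j; exact: bounded_mfunZ.
have k0 : 0 < m%:R / 16 :> R by rewrite divr_gt0.
have Fflip (v : V) j : F (flip j v) j = F v j.
  by apply/funext => z; exact: cross_term_flip.
have avg := average_le s01 k0 bF Fflip (fun v z => cross_term_sqr_sum m0 v (sthetahat z)).
have low (v : V) : 7 / 5 * (1 - (m%:R^-1 +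
    \int[P 1 v]_z (\sum_(j < m) sgb (v j) * F v j z)) / 2) <= eps.
  pose g z := 7 / 5 * (1 - m%:R^-1 / 2) - 7 / 10 * \sum_(j < m) sgb (v j) * F v j z.
  have bg : bounded_mfun g.
    by apply: bounded_mfunB; [exact: bounded_mfun_cst|exact: bounded_mfunZ].
  have : \int[P 1 v]_z g z <= eps.
    apply: vertex_risk => // z.
    apply: le_trans (enorm_subv_sphere_ge (sthetahat z) (vertex_sphere m0 s01 v)).
    have := dotv_vertex_cross v (sthetahat z); rewrite /g -/(F v).
    move: (dotv _ _) (\sum_(j < m) _) m%:R^-1 => t A q H; lra.
  rewrite /g prob_RintegralB//; [|exact: bounded_mfun_cst|exact: bounded_mfunZ].
  rewrite prob_Rintegral_cst prob_RintegralZ//.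
  move: (\int[_]_z _) m%:R^-1 => A q H; lra.
have {low} : \sum_(v : V) (7 / 5 * (1 - m%:R^-1 / 2) - 7 / 10 *
    \int[P 1 v]_z (\sum_(j < m) sgb (v j) * F v j z)) <= eps * #|V|%:R.
  rewrite -sum_vertices; apply: ler_sum => v _; apply: le_trans (low v).
  by move: (\int[_]_z _) m%:R^-1 => A q; lra.
rewrite sumrB sum_vertices -mulr_sumr.
move: avg; move: (\sum_(v : V) _) #|V|%:R V0 => A N N0 avg low.
rewrite -(ler_pM2r N0); apply: le_trans low.
have E : m%:R * (eta 1 / (m%:R / 16)) + m%:R / 16 / 2 * (4 / m%:R) = 16 * eta 1 + 8^-1.
  by move: (eta 1) => x; field; rewrite gt_eqF.
rewrite E in avg.
move: (eta 1) m%:R^-1 avg => x q; lra.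
Qed.

End lower_bound.

Theorem theorem1 (R : realType) (d n : nat) (beta eps : R)
    (thetahat : n.-tuple (d.-tuple R * bool) -> d.-tuple R) :
  (1 <= d)%N -> (1 <= n)%N -> 0 < beta -> 0 < eps < 1 ->
  measurable_fun [set: n.-tuple (d.-tuple R * bool)] thetahat ->
  (forall s, sphere (thetahat s)) ->
  (forall theta : d.-tuple R, sphere theta ->
    ('E_(iid_prob (logistic_law theta beta) n)
       [fun s => enorm (subv (thetahat s) theta)] <= eps%:E)%E) ->
  ((d%:R - 1) * ln 2 - ln 4) /
    (32 * eps ^+ 2 * beta * Num.min beta (2 * Num.sqrt (2 / pi))) <= n%:R.
Proof.
move=> d1 n1 beta0 /andP[eps0 eps1] mth sth risk.
case: d d1 thetahat mth sth risk => // m _ th mth sth risk.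
rewrite (_ : ln 4 = 2 * ln 2 :> R); last first.
  have -> : 4 = 2 ^+ 2 :> R by ring.
  by rewrite lnXn// mulr_natl.
have -> : (m.+1%:R - 1) * ln 2 - 2 * ln 2 = (m%:R - 2) * ln 2 :> R.
  by rewrite -[m.+1]addn1 natrD; ring.
rewrite -[32 * _ * _ * _]mulrA -/(information_rate beta).
have ln2_ge0 : 0 <= ln 2 :> R by rewrite ln_ge0//; lra.
have ln2_le1 : ln 2 <= 1 :> R.
  by have := @le_ln1Dx R 1; rewrite (_ : 1 + 1 = 2 :> R) //; apply; lra.
have K0 : 0 < information_rate beta.
  apply: mulr_gt0 => //; rewrite lt_min beta0/=; apply: mulr_gt0 => //.
  by rewrite sqrtr_gt0; apply: divr_gt0 => //; exact: pi_gt0.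
have den0 : 0 < 32 * eps ^+ 2 * information_rate beta.
  by apply: mulr_gt0 => //; apply: mulr_gt0; [lra|exact: exprn_gt0].
rewrite ler_pdivrMr//.
have nK0 : 0 <= n%:R * information_rate beta by rewrite mulr_ge0// ltW.
have [m3|m3] := leqP 3 m; last first.
  (* the numerator is nonpositive *)
  apply: (@le_trans _ _ 0); last by rewrite mulr_ge0// ltW.
  have : (m%:R : R) <= 2 by rewrite (ler_nat R m 2).
  by move=> m2; rewrite mulr_le0_ge0// subr_le0.
have m3R : (3 : R) <= m%:R by rewrite (ler_nat R 3).
have m0R : (0 : R) < m%:R by lra.
apply: (@le_trans _ _ (m%:R - 2)); first by rewrite ler_piMr//; lra.
have -> : n%:R * (32 * eps ^+ 2 * information_rate beta) =
  32 * eps ^+ 2 * (n%:R * information_rate beta) by ring.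
have [e2|e2] := lerP eps 2^-1.
  have := small_eps_bound m3 beta0 mth sth risk; rewrite eps0 e2 => /(_ isT).
  rewrite /sample_hellinger.
  have -> : n%:R * (5 / 16 * information_rate beta * ((2 * eps) ^+ 2 / m%:R)) =
    (5 / 4 * (eps ^+ 2 * (n%:R * information_rate beta))) / m%:R.
    by move: (information_rate beta) => K; field; rewrite gt_eqF.
  rewrite ler_pdivlMr// -[32 * _ * _]mulrA.
  by move: (eps ^+ 2 * _) m3R => x m3R H; lra.
have := large_eps_bound m3 beta0 mth sth risk; rewrite /sample_hellinger.
have -> : 16 * (n%:R * (5 / 16 * information_rate beta * (1 ^+ 2 / m%:R))) =
    5 * (n%:R * information_rate beta) / m%:R.
  by move: (information_rate beta) => K; field; rewrite gt_eqF.
move: (n%:R * information_rate beta) nK0 => X X0 H.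
have {}H : m%:R * (15 / 8 - 10 / 7 * eps) - 1 <= 5 * X.
  have mV : m%:R * m%:R^-1 = 1 :> R by rewrite divff// gt_eqF.
  move: m%:R m%:R^-1 mV m0R H {m3R} => M q Mq M0 H.
  have : M * (7 / 5 * (1 - (q + 5 * X * q + 8^-1) / 2)) <= M * eps by rewrite ler_pM2l.
  have -> : M * (7 / 5 * (1 - (q + 5 * X * q + 8^-1) / 2)) =
    7 / 5 * (M * (15 / 16) - (M * q) / 2 - 5 * X * (M * q) / 2) by field.
  by rewrite Mq; lra.
move: m%:R m3R H => M M3 H.
have e20 : 0 < eps ^+ 2 by rewrite exprn_gt0.
have : 32 / 5 * eps ^+ 2 * (M * (15 / 8 - 10 / 7 * eps) - 1) <= 32 * eps ^+ 2 * X.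
  have -> : 32 * eps ^+ 2 * X = 32 / 5 * eps ^+ 2 * (5 * X) by field.
  by rewrite ler_pM2l// mulr_gt0//; lra.
apply: le_trans.
have q1 : 0 <= (eps - 2^-1) * (1 - eps) by apply: mulr_ge0; lra.
have q2 : 0 <= (eps - 2^-1) * (1 - eps) * eps by apply: mulr_ge0 => //; lra.
pose slope := 12 * eps ^+ 2 - 64 / 7 * eps ^+ 3 - 1.
have slope0 : 0 <= slope by rewrite /slope; nra.
(* the claim is affine in M with slope [slope] >= 0, so M = 3 is the worst case *)
rewrite -subr_ge0.
have -> : 32 / 5 * eps ^+ 2 * (M * (15 / 8 - 10 / 7 * eps) - 1) - (M - 2) =
  slope * (M - 3) + (3 * slope - 32 / 5 * eps ^+ 2 + 2) by rewrite /slope; field.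
apply: addr_ge0; first by rewrite mulr_ge0//; lra.
rewrite /slope; nra.
Qed.
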